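(* Assume that there exist $\mathfrak c$ pairwise incomparable selective ultrafilters on $\omega$. Then for each $M<\omega$ there exists a group topology on the free Abelian group $G$ of cardinality $\mathfrak c$ such that $G^M$ is countably compact and $G^{M+1}$ is not countably compact.
   Context: All group topologies are Hausdorff, and powers carry the product topology. $\mathfrak c=2^{\aleph_0}$. A free ultrafilter $p$ on $\omega$ is selective if for every partition $\{P_n:n\in\omega\}$ of $\omega$ either some $P_n\in p$ or there is $B\in p$ with $|B\cap P_n|\le 1$ for all $n$. Two ultrafilters $p,q$ on $\omega$ are incomparable if they are incomparable in the Rudin–Keisler order, where $p\le_{RK}q$ means that there is $f:\omega\to\omega$ such that $p=\{A\subseteq\omega: f^{-1}(A)\in q\}$. A space is countably compact if every sequence in it has an accumulation point, where $x$ is an accumulation point of $(x_n)_{n\in\omega}$ if every neighbourhood of $x$ contains $x_n$ for infinitely many $n$. *)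

(* Defs.v *)
From HB Require Import structures.
From mathcomp Require Import all_boot all_algebra.
From mathcomp Require Import all_classical all_reals all_analysis.
From mathcomp Require Import freeg.

Set Implicit Arguments.
Unset Strict Implicit.
Unset Printing Implicit Defensive.

Import GRing.Theory.
Local Open Scope classical_set_scope.
Local Open Scope card_scope.

Definition free_ultrafilter (p : set_system nat) :=
  UltraFilter p /\ \bigcap_(A in p) A = set0.

(* A partition indexed by nat has nonempty parts, hence infinitely many of them;
   for a partition into finitely many parts the first alternative is automatic,
   so nothing is lost. *)
Definition selective (p : set_system nat) :=
  free_ultrafilter p /\
  forall P : nat -> set nat, partition setT P setT ->
    (exists n, p (P n)) \/
    (exists2 B, p B & forall n, B `&` P n #<= `I_1).

Definition rk_le (p q : set_system nat) :=
  exists f : nat -> nat, p = [set A | q (f @^-1` A)].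

Definition rk_incomparable (p q : set_system nat) := ~ rk_le p q /\ ~ rk_le q p.

(* Terms of [u] are counted with their indices, so a value taken infinitely often
   is an accumulation point; this differs from limit points of [range u]. *)
Definition accumulation_point (X : topologicalType) (u : nat -> X) (x : X) :=
  forall U, nbhs x U -> infinite_set [set n | U (u n)].

Definition countably_compact (X : topologicalType) :=
  forall u : nat -> X, exists x, accumulation_point u x.

(* The cardinal of [set nat] is 2 ^ aleph_0. *)
Definition has_card_continuum (T : Type) (A : set T) := A #= [set: set nat].

(* [{freeg K}] is the group of formal integer combinations of elements of [K]. *)
Definition free_abelian (G : zmodType) :=
  exists (K : choiceType) (f : {additive {freeg K} -> G}), bijective f.

(* Main.v *)
Require Import Defs.
From HB Require Import structures.
From mathcomp Require Import all_boot all_order all_algebra.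
From mathcomp Require Import all_classical all_reals all_analysis.
From mathcomp Require Import ring lra zify freeg.
From mathcomp Require Rstruct.
From mathcomp.real_closed Require Import complex.

Set Implicit Arguments.
Unset Strict Implicit.
Unset Printing Implicit Defensive.

Import Order.TTheory GRing.Theory Num.Theory.
Import numFieldNormedType.Exports.
Local Open Scope classical_set_scope.
Local Open Scope card_scope.
Local Open Scope ring_scope.

(** The free generators are indexed by a well-founded tree type in which, for every
   [k]-tuple of sequences of words, there are [k] fresh letters [node k q w f],
   [q < k], meant to be the limits of the tuple along a selective ultrafilter that is
   used for no other tuple.  The topology is induced by all homomorphisms into the
   circle for which these letters are indeed the limits, for every tuple with
   [k <= M] none of whose nontrivial integer combinations is constant infinitely
   often.  The Smith normal form reduces any [k]-tuple to such a tuple, whence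
   [G^M] is countably compact.

   Homomorphisms with prescribed approximate values on finitely many generators are
   built on countably many letters by shrinking arcs.  Selectivity and
   incomparability allow the limit laws to be treated one index [n] at a time; at
   each index a quantitative Kronecker theorem moves the values into position.  The
   other letters then follow by taking ultrafilter limits.  Besides, there are free
   letters [block i n], [i <= M].  As each step imposes at most [M] linear
   conditions, every new block of [M + 1] values can be moved away from any
   prescribed point, so that [n |-> (block i n)_i] has no accumulation point in
   [G^(M + 1)].

   Circle values are real numbers modulo [pi], measured by [|sin|]. *)

(** * The circle pseudo-norm [|sin|] and exponential sums *)

(** The two halves pull against each other: every [M]-tuple needs limits, yet a block of [M + 1]
    letters must stay free to escape. Hence one law per index: incomparability makes the sets on
    which laws act disjoint, so the numbers of conditions from different tuples never add up beyond
    [M]. A step is possible at a late index because finitely many combinations of the words matter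
    there, and each of them can stay among the committed letters with small coefficients only
    finitely often. Afterwards it has a fresh letter or a large coefficient, which is what
    Kronecker's theorem needs. How late is late depends on the arcs left by the preceding step, so
    the ultrafilter sets must have prescribed gaps. Trees are used because limit letters are also
    needed for sequences of words that contain limit letters; well-foundedness lets values be
    defined by recursion. A tree is coded by a set of countable data, so there are continuum many
    trees, as many as ultrafilters and as basis elements of [G]. Working with [|sin|], which is
    subadditive and periodic modulo [pi], avoids forming a quotient group. *)

Section CircleNorm.
Variable R : realType.
Implicit Types x y : R.

Lemma norm_sinD x y : `|sin (x + y)| <= `|sin x| + `|sin y|.
Proof.
rewrite sinD (le_trans (ler_normD _ _)) // !normrM lerD //.
  by rewrite ler_piMr ?normr_ge0 ?cos_max.
by rewrite ler_piMl ?normr_ge0 ?cos_max.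
Qed.

Lemma norm_sinN x : `|sin (- x)| = `|sin x|.
Proof. by rewrite sinN normrN. Qed.

Lemma norm_sin_sum (I : Type) (r : seq I) (F : I -> R) :
  `|sin (\sum_(i <- r) F i)| <= \sum_(i <- r) `|sin (F i)|.
Proof.
elim: r => [|i r IH]; first by rewrite !big_nil sin0 normr0.
by rewrite !big_cons (le_trans (norm_sinD _ _)) // lerD2l.
Qed.

Lemma norm_sinMz (m : int) x : `|sin (m%:~R * x)| <= `|m|%:~R * `|sin x|.
Proof.
have H (n : nat) : `|sin (n%:R * x)| <= n%:R * `|sin x|.
  elim: n => [|n IH]; first by rewrite !mul0r sin0 normr0.
  rewrite -addn1 natrD !mulrDl !mul1r (le_trans (norm_sinD _ _)) //.
  by rewrite lerD2r.
case: m => n; first exact: H.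
by rewrite NegzE mulrNz mulNr norm_sinN normrN; exact: H.
Qed.

Lemma norm_sin_le x : `|sin x| <= `|x|.
Proof.
wlog x0 : x / 0 <= x.
  move=> H; have [/H//|/ltW x0] := leP 0 x.
  by rewrite -norm_sinN -(normrN x); apply: H; rewrite oppr_ge0.
have [|c _] := @MVT_segment R sin cos 0 x x0.
  by apply: continuous_subspaceT => y; exact: continuous_sin.
rewrite sin0 !subr0 => ->; rewrite normrM.
by rewrite ler_piMl ?normr_ge0 ?cos_max.
Qed.

Lemma norm_sin_ge x : `|x| <= 1 -> `|x| / 2 <= `|sin x|.
Proof.
wlog x0 : x / 0 <= x.
  move=> H; have [/H//|/ltW x0] := leP 0 x.
  by rewrite -norm_sinN -(normrN x); apply: H; rewrite oppr_ge0.
rewrite (ger0_norm x0) => x1.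
have [|c] := @MVT_segment R sin cos 0 x x0.
  by apply: continuous_subspaceT => y; exact: continuous_sin.
rewrite in_itv /= sin0 !subr0 => /andP[c0 cx] ->.
(* Half-angle formula: [cos c = 1 - 2 sin^2 (c / 2)], and [|sin (c / 2)| <= c / 2 <= 1 / 2]. *)
have cc : 2^-1 <= cos c.
  have -> : c = (c / 2) *+ 2 by rewrite -mulr_natr divfK.
  have := norm_sin_le (c / 2); rewrite (@ger0_norm _ (c / 2)) ?divr_ge0 // => h.
  have : `|sin (c / 2)| ^+ 2 <= (c / 2) ^+ 2.
    by rewrite lerXn2r ?nnegrE ?normr_ge0 ?divr_ge0.
  rewrite real_normK ?num_real // sin2cos2 cos_mulr2n => h2.
  have : (c / 2) ^+ 2 <= (2^-1) ^+ 2.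
    by rewrite lerXn2r ?nnegrE ?divr_ge0 // ?invr_ge0 // ler_pdivrMr // mulVf // (le_trans cx).
  rewrite expr2; nra.
by rewrite ger0_norm ?mulr_ge0 // ?(le_trans _ cc) ?invr_ge0 // mulrC ler_wpM2r.
Qed.

End CircleNorm.

Section Cis.
Variable R : realType.
Local Notation C := R[i].
Implicit Types x y : R.

Definition cis x : C := (cos x +i* sin x)%C.

Lemma cisD x y : cis (x + y) = cis x * cis y.
Proof. by rewrite /cis cosD sinD; simpc; congr Complex; rewrite addrC. Qed.

Lemma cis0 : cis 0 = 1.
Proof. by rewrite /cis cos0 sin0. Qed.

Lemma cis_sum (I : Type) (r : seq I) (P : pred I) (F : I -> R) :
  cis (\sum_(i <- r | P i) F i) = \prod_(i <- r | P i) cis (F i).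
Proof. by rewrite (big_morph _ cisD cis0). Qed.

Lemma cisMn x n : cis (x *+ n) = cis x ^+ n.
Proof.
elim: n => [|n IH]; first by rewrite mulr0n cis0.
by rewrite mulrS cisD IH exprS.
Qed.

Lemma norm_cis x : `|cis x| = 1.
Proof. by rewrite normc_def /= cos2Dsin2 sqrtr1. Qed.

Lemma cos_cis x : (cos x)%:C%C = (cis x + cis (- x)) / 2%:R :> C.
Proof.
rewrite /cis cosN sinN.
apply: (@mulIf _ 2%:R); first by rewrite pnatr_eq0.
rewrite divfK ?pnatr_eq0 //.
rewrite -[2%:R](rmorph_nat (real_complex R)) /=.
by simpc; rewrite mulr_natr.
Qed.

(** A geometric sum: the denominator satisfies [|cis x - 1| = 2 |sin (x / 2)|], and the numerator
    has norm at most 2. *)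
Lemma norm_sum_cis N x : sin (x / 2) != 0 ->
  `|\sum_(l < N) cis (x *+ l)| <= (`|sin (x / 2)|^-1)%:C%C.
Proof.
move=> s0.
have key : cis x - 1 = 2%:R * (sin (x / 2))%:C%C * 'i%C * cis (x / 2).
  have {1}-> : x = x / 2 + x / 2 by rewrite -splitr.
  have {1}<- : cis (x / 2) * cis (- (x / 2)) = 1 by rewrite -cisD subrr cis0.
  rewrite cisD -mulrBr mulrC; congr (_ * _).
  have e2 : 2%:R = (2%:R)%:C%C :> C by rewrite rmorph_nat.
  rewrite /cis cosN sinN e2.
  by simpc; congr Complex; rewrite ?subrr ?oppr0 // mulr2n mulrDl !mul1r.
have : (cis x - 1) * \sum_(l < N) cis (x *+ l) = cis (x *+ N) - 1.
  by rewrite cisMn subrX1; congr (_ * _); apply: eq_bigr => l _; rewrite cisMn.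
move=> /(congr1 (fun z : C => `|z|)); rewrite normrM key !normrM norm_cis.
have -> : `|'i%C| = 1 :> C by rewrite normc_def /= expr0n expr1n add0r sqrtr1.
rewrite !mulr1 normr_nat => h.
have ->: (`|sin (x / 2)|^-1)%:C%C = `|(sin (x / 2))%:C%C|^-1 :> C.
  by rewrite fmorphV /= normc_def /= expr0n addr0 sqrtr_sqr.
have p : 0 < `|(sin (x / 2))%:C%C| :> C.
  rewrite normr_gt0; apply: contraNneq s0 => /(congr1 (@complex.Re R)) /= ->.
  by rewrite eqxx.
rewrite -[leRHS]mulr1 ler_pdivlMl //.
suff : 2%:R * `|(sin (x / 2))%:C%C| * `|\sum_(l < N) cis (x *+ l)| <= 2%:R :> C.
  by rewrite -mulrA -[X in _ <= X]mulr1 ler_pM2l // ltr0n.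
rewrite h (le_trans (ler_normB _ _)) // norm_cis normr1 -(natrD _ 1 1).
by [].
Qed.

End Cis.

(** * A quantitative Kronecker theorem *)

Section Kronecker.
Variable R : realType.
Local Notation C := R[i].

(** The Fourier coefficient of [cos ^+ D.*2] at frequency [2 (D - l)]; the constant term is the one
    with [l = D]. *)
Definition bcoef (D l : nat) : R := 'C(D.*2, l)%:R / 4 ^+ D.

Lemma bcoef_ge0 D l : 0 <= bcoef D l.
Proof. by rewrite divr_ge0 ?ler0n ?exprn_ge0. Qed.

(** A crude bound suffices: the constant term of [cos ^+ D.*2] need only decay polynomially in
    [D]. *)
Lemma central_binomial D : (4 ^ D <= D.+1 * 'C(D.*2, D))%N.
Proof.
elim: D => [//|D IH].
have e1 : 'C(D.+1.*2, D.+1) = ('C(D.*2.+1, D)).*2.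
  by rewrite doubleS binS -[X in ('C(X, D.+1) + _)%N]/(D.*2.+1)%N -(@bin_sub D.*2.+1 D.+1) ?subSS -?addnn ?addnK ?leq_addr // addnn.
have e2 : (D.+1 * 'C(D.*2.+1, D) = D.*2.+1 * 'C(D.*2, D))%N.
  have := mul_bin_left D.*2.+1 D; have := mul_bin_diag D.*2.+1 D.
  rewrite /= => <-; have -> : (D.*2.+1 - D = D.+1)%N by rewrite -addnn; lia.
  by move=> ->.
rewrite e1 expnS.
have : (D.+1 * (4 * 4 ^ D) <= D.+1 * (D.+2 * 'C(D.*2.+1, D).*2))%N.
  have -> : (D.+1 * (D.+2 * 'C(D.*2.+1, D).*2) = D.+2 * 2 * (D.+1 * 'C(D.*2.+1, D)))%N by lia.
  rewrite e2; have : (4 * (D.+1 * 'C(D.*2, D)) * D.+1 <= D.+2 * 2 * (D.*2.+1 * 'C(D.*2, D)))%N.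
    have -> : D.*2 = (2 * D)%N by lia. 
    by move: 'C(_, _) => c; nia.
  by move: IH; set c := 'C(_, _); set q := (4 ^ D)%N; nia.
by rewrite leq_pmul2l.
Qed.

Lemma bcoef_central D : (D.+1)%:R^-1 <= bcoef D D.
Proof.
rewrite /bcoef ler_pdivlMr ?exprn_gt0 // mulrC ler_pdivrMr ?ltr0n //.
by rewrite -natrX -natrM ler_nat mulnC central_binomial.
Qed.

Lemma cos_pow_expand D (u : R) :
  (cos u ^+ D.*2)%:C%C =
  \sum_(l < D.*2.+1) (bcoef D l)%:C%C * cis (2 * (D%:R - l%:R) * u) :> C.
Proof.
rewrite rmorphXn /= cos_cis exprMn exprDn mulr_suml; apply: eq_bigr => l _.
have lD : (l <= D.*2)%N by rewrite -ltnS.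
rewrite -!cisMn -cisD -mulr_natl /bcoef rmorphM /= rmorph_nat -mulrA mulrAC mulrA.
congr (_ * _ * _).
  congr cis; rewrite -[u *+ _]mulr_natr natrB //.
  have -> : D.*2%:R = D%:R + D%:R :> R by rewrite -addnn natrD.
  by rewrite -mulr_natr; ring.
by rewrite fmorphV rmorphXn /= rmorph_nat exprVn -addnn addnn -mul2n exprM -natrX.
Qed.

Lemma sum_bcoef D : \sum_(l < D.*2.+1) bcoef D l = 1.
Proof.
have := cos_pow_expand D 0; rewrite cos0 expr1n.
under eq_bigr do rewrite mulr0 cis0 mulr1.
by rewrite -rmorph_sum /= => /(congr1 (@complex.Re R)).
Qed.

Lemma cos_prod_expand k D (u : 'I_k -> R) :
  (\prod_i cos (u i) ^+ D.*2)%:C%C =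
  \sum_(f : {ffun 'I_k -> 'I_D.*2.+1}) (\prod_i bcoef D (f i))%:C%C *
    cis (\sum_i 2 * (D%:R - (f i)%:R) * u i) :> C.
Proof.
rewrite rmorph_prod /=; under eq_bigr do rewrite cos_pow_expand.
rewrite bigA_distr_bigA /=; apply: eq_bigr => f _.
by rewrite big_split /= rmorph_prod cis_sum.
Qed.

Definition avg_cis n N (b : 'I_n -> R) : C :=
  \sum_(f : {ffun 'I_n -> 'I_N}) cis (\sum_j b j *+ f j) / N%:R ^+ n.

(** The mean over the grid is a product of one-variable means, all of norm at most 1; the geometric
    sum in the variable [j] gives the bound. *)
Lemma norm_avg_cis n N (b : 'I_n -> R) j (Q : R) : (0 < N)%N -> 0 < Q ->
  `|b j| <= 2 -> Q <= `|b j / 2| * N%:R ->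
  `|avg_cis N b| <= (2 / Q)%:C%C.
Proof.
move=> N0 Q0 b1 bQ.
have N0' : (0 : R) < N%:R by rewrite ltr0n.
have -> : avg_cis N b = \prod_j ((\sum_(l < N) cis (b j *+ l)) / N%:R).
  rewrite /avg_cis; under [RHS]eq_bigr do rewrite mulr_suml.
  rewrite bigA_distr_bigA /=; apply: eq_bigr => f _.
  by rewrite big_split /= cis_sum prodr_const card_ord exprVn.
rewrite (bigD1 j) //= normrM normr_prod.
have nN : `|(N%:R : C)^-1| = N%:R^-1 by rewrite normrV ?unitfE ?pnatr_eq0 -?lt0n // normr_nat.
have le1 i : `|(\sum_(l < N) cis (b i *+ l)) / N%:R| <= 1 :> C.
  rewrite normrM nN ler_pdivrMr ?ltr0n // mul1r.
  rewrite (le_trans (ler_norm_sum _ _ _)) //.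
  under eq_bigr do rewrite norm_cis.
  by rewrite sumr_const card_ord.
apply: (@le_trans _ _ (`|(\sum_(l < N) cis (b j *+ l)) / N%:R| * 1)).
  rewrite ler_wpM2l ?normr_ge0 //.
  by apply: prodr_ile1 => i _; rewrite normr_ge0 le1.
rewrite mulr1 normrM nN.
have b2 : `|b j / 2| <= 1 by rewrite normrM normfV normr_nat ler_pdivrMr // mul1r.
have s := norm_sin_ge b2.
have bp : 0 < `|b j / 2| by rewrite -(pmulr_lgt0 _ N0') (lt_le_trans Q0).
have sp : 0 < `|sin (b j / 2)| by apply: lt_le_trans s; rewrite divr_gt0.
rewrite ler_pdivrMr ?ltr0n //.
apply: le_trans (norm_sum_cis _ _) _; first by rewrite -normr_gt0.
rewrite -[N%:R](rmorph_nat (real_complex R)) -rmorphM /= lecR.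
rewrite -[leLHS]mul1r ler_pdivrMr //.
rewrite (_ : _ / Q * _ * _ = 2 * (N%:R * `|sin (b j / 2)|) / Q); last by ring.
rewrite ler_pdivlMr // mul1r.
have : `|b j / 2| / 2 * N%:R <= `|sin (b j / 2)| * N%:R by rewrite ler_wpM2r // ltW.
move: bQ; set x := `|b j / 2|; set y := `|sin _|; set z := N%:R; nra.
Qed.
End Kronecker.

Section Kronecker2.
Variable R : realType.
Local Notation C := R[i].

Lemma bernoulli_ineq (x : R) m : 0 <= x -> 1 + m%:R * x <= (1 + x) ^+ m.
Proof.
move=> x0; elim: m => [|m IH]; first by rewrite mul0r addr0 expr0.
rewrite exprS -natr1.
have x1 : 0 <= 1 + x by rewrite addr_ge0.
have := ler_wpM2l x1 IH; apply: le_trans.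
have : 0 <= m%:R * (x * x) by rewrite mulr_ge0 ?ler0n ?mulr_ge0.
nra.
Qed.

Lemma geometric_beats_poly (q : R) k : 0 <= q < 1 ->
  exists D, 2 * (q ^+ D * (D.+1%:R) ^+ k) < 1.
Proof.
move=> /andP[q0 q1]; pose e := 1 - q; have e0 : 0 < e by rewrite subr_gt0.
(* With [D = m (k + 1)], Bernoulli and [q (1 + e) <= 1] give [q ^+ D <= (m e) ^- (k + 1)], while
   [(D + 1) ^+ k <= ((k + 2) m) ^+ k]. One factor [m] is left over, and it has to beat the remaining
   constants. *)
pose m := (Num.truncn (2 * k.+2%:R ^+ k / e ^+ k.+1)).+1.
have me : 2 * k.+2%:R ^+ k < e ^+ k.+1 * m%:R.
  by rewrite [ltRHS]mulrC -ltr_pdivrMr ?exprn_gt0 //; exact: (real_truncnS_gt (num_real _)).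
exists (m * k.+1)%N.
have mp : (0 < m)%N by [].
have b : (m%:R * e) ^+ k.+1 <= (1 + e) ^+ (m * k.+1).
  have h : m%:R * e <= (1 + e) ^+ m.
    by apply: le_trans (bernoulli_ineq m (ltW e0)); rewrite lerDr.
  have h0 : 0 <= m%:R * e by rewrite mulr_ge0 ?ler0n // ltW.
  by rewrite exprM lerXn2r ?nnegrE // (le_trans h0).
have c : q ^+ (m * k.+1) * (1 + e) ^+ (m * k.+1) <= 1.
  have h0 : 0 <= q * (1 + e) by rewrite mulr_ge0 // addr_ge0 // ltW.
  have h1 : q * (1 + e) <= 1.
    by rewrite /e -subr_ge0 (_ : _ - _ = (1 - q) ^+ 2) ?sqr_ge0 //; ring.
  by rewrite -exprMn exprn_ile1.
have d : (m * k.+1).+1%:R ^+ k <= (k.+2%:R * m%:R) ^+ k :> R.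
  by rewrite lerXn2r ?nnegrE ?mulr_ge0 ?ler0n // -natrM ler_nat; nia.
have qp : 0 <= q ^+ (m * k.+1) by rewrite exprn_ge0.
have mr : (0 : R) < m%:R by rewrite ltr0n.
have step : 2 * (q ^+ (m * k.+1) * (m * k.+1).+1%:R ^+ k) <=
   q ^+ (m * k.+1) * (2 * k.+2%:R ^+ k * m%:R ^+ k).
  by rewrite mulrCA ler_wpM2l // -mulrA ler_pM2l // -exprMn.
apply: le_lt_trans step _.
have [q00|qn0] := eqVneq (q ^+ (m * k.+1)) 0; first by rewrite q00 mul0r.
have qp' : 0 < q ^+ (m * k.+1) by rewrite lt_neqAle eq_sym qn0.
apply: lt_le_trans c; rewrite ltr_pM2l //; apply: lt_le_trans b.
have -> : (m%:R * e) ^+ k.+1 = e ^+ k.+1 * m%:R * m%:R ^+ k.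
  by rewrite exprMn (exprS m%:R); ring.
by rewrite ltr_pM2r // exprn_gt0.
Qed.

(* Average the test function [\prod_i cos (u_i) ^+ 2D] over a fine grid of the box:
   its mean over the torus decays polynomially in [D], whereas its values away from
   the target decay geometrically. *)
Lemma kronecker_box k (eps : R) : 0 < eps ->
  exists (D : nat) (Q : R), 0 < Q /\
  forall n (c : 'I_k -> 'I_n -> int) (x d : 'I_n -> R) (th : 'I_k -> R),
  (forall j, 0 <= d j) ->
  (forall r : 'I_k -> int, (exists i, r i != 0) -> (forall i, `|r i| <= D%:Z) ->
     exists j, Q <= `|\sum_i r i * c i j|%:~R * d j) ->
  exists y : 'I_n -> R, (forall j, `|y j - x j| <= d j) /\
    forall i, `|sin (\sum_j (c i j)%:~R * y j - th i)| < eps.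
Proof.
move=> e0.
(* Bounds [cos ^+ 2] at any point where [|sin|] is at least [eps], that is, wherever a target is
   missed. *)
pose q := Num.max 0 (1 - eps ^+ 2).
have q01 : 0 <= q < 1.
  by rewrite le_max lexx /= gt_max ltr01 /= ltrBlDr ltrDl exprn_gt0.
have [D Dq] := geometric_beats_poly k q01.
(* Makes [2 / Q] half of the lower bound [(D + 1) ^- k] for the constant term, so that the other
   frequencies cannot cancel it. *)
pose Q : R := 4 * D.+1%:R ^+ k.
have Q0 : 0 < Q by rewrite mulr_gt0 ?exprn_gt0.
exists D, Q; split => // n c x d th d0 H.
apply: contrapT => Hno.
pose rr (g : {ffun 'I_k -> 'I_D.*2.+1}) i : int := D%:Z - (g i : nat)%:Z.
pose z g j : R := d j * (\sum_i rr g i * c i j)%:~R.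
(* The grid is so fine that every phase increment [B g j] has absolute value at most 2, where
   [|sin (B / 2)|] is comparable to [|B / 2|]. *)
pose N := (Num.truncn (\sum_g \sum_j `|z g j|)).+1.
have N0 : (0 < N)%N by [].
have N0' : (0 : R) < N%:R by rewrite ltr0n.
have zN g j : `|z g j| <= N%:R.
  have /ltW : \sum_g \sum_j `|z g j| < N%:R by exact: (real_truncnS_gt (num_real _)).
  apply: le_trans; rewrite (bigD1 g) //= (bigD1 j) //= -addrA lerDl.
  by rewrite addr_ge0 ?sumr_ge0 // => *; rewrite ?sumr_ge0.
pose y (f : {ffun 'I_n -> 'I_N}) j : R := x j + d j * (f j)%:R / N%:R.
pose u f i := \sum_j (c i j)%:~R * y f j - th i.
pose P f : R := \prod_i cos (u f i) ^+ D.*2.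
have Pq f : P f <= q ^+ D.
  have [i hi] : exists i, eps <= `|sin (u f i)|.
    apply: contrapT => nex; apply: Hno; exists (y f); split => [j|i].
      rewrite /y addrC addKr normrM normfV normrM (ger0_norm (d0 j)) !normr_nat.
      by rewrite ler_pdivrMr // ler_wpM2l // ler_nat ltnW.
    by rewrite ltNge; apply/negP => hi; apply: nex; exists i.
  rewrite /P (bigD1 i) //=.
  have c2 j : cos (u f j) ^+ D.*2 = (cos (u f j) ^+ 2) ^+ D by rewrite -exprM mul2n.
  have ci : cos (u f i) ^+ D.*2 <= q ^+ D.
    rewrite c2 lerXn2r ?nnegrE ?sqr_ge0 //; first by case/andP: q01.
    rewrite /q le_max; apply/orP; right.
    rewrite cos2sin2 lerD2l lerN2 -[leRHS](@real_normK _ (sin _)) ?num_real //.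
    by rewrite lerXn2r ?nnegrE ?normr_ge0 ?(ltW e0).
  rewrite -[leRHS]mulr1 ler_pM ?prodr_ge0 //.
  - by rewrite c2 exprn_ge0 ?sqr_ge0.
  - by move=> j _; rewrite c2 exprn_ge0 ?sqr_ge0.
  apply: prodr_ile1 => j _; rewrite c2 exprn_ge0 ?sqr_ge0 //=.
  by rewrite exprn_ile1 ?sqr_ge0 // cos2sin2 gerBl sqr_ge0.
pose w : R := (N%:R ^+ n)^-1.
have w0 : 0 < w by rewrite invr_gt0 exprn_gt0.
have sumw : \sum_(f : {ffun 'I_n -> 'I_N}) w = 1.
  rewrite sumr_const card_ffun !card_ord -[w *+ _]mulr_natl natrX divff //.
  by rewrite expf_neq0 // pnatr_eq0.
have up : \sum_f P f * w <= q ^+ D.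
  rewrite -[leRHS]mulr1 -sumw mulr_sumr; apply: ler_sum => f _.
  by rewrite ler_wpM2r // ltW.
pose A g : R := \sum_i 2 * (rr g i)%:~R * (\sum_j (c i j)%:~R * x j - th i).
pose B g j : R := 2 * z g j / N%:R.
have phase (f : {ffun 'I_n -> 'I_N}) (g : {ffun 'I_k -> 'I_D.*2.+1}) : \sum_i 2 * (D%:R - (g i : nat)%:R) * u f i = A g + \sum_j B g j *+ f j.
  rewrite /A /B /z /u /y.
  have -> : \sum_(j < n) (2 * (d j * (\sum_i rr g i * c i j)%:~R) / N%:R) *+ f j =
     \sum_i \sum_j 2 * (rr g i)%:~R * ((c i j)%:~R * (d j * (f j)%:R / N%:R)).
    rewrite exchange_big /=; apply: eq_bigr => j _.
    rewrite -[LHS]mulr_natr rmorph_sum /= !(mulr_sumr, mulr_suml).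
    by apply: eq_bigr => i _; rewrite rmorphM /=; ring.
  rewrite -big_split /=; apply: eq_bigr => i _.
  rewrite /rr rmorphB /= -!pmulrn -mulr_sumr -mulrDr; congr (_ * _).
  rewrite addrAC -big_split /=; congr (_ - _); apply: eq_bigr => j _.
  by rewrite mulrDr.
have expand : (\sum_f P f * w)%:C%C =
    \sum_(g : {ffun 'I_k -> 'I_D.*2.+1}) (\prod_i bcoef R D (g i))%:C%C * (cis (A g) * avg_cis N (B g)) :> C.
  rewrite rmorph_sum /=; under eq_bigr do rewrite rmorphM /= /P cos_prod_expand mulr_suml.
  rewrite exchange_big /=; apply: eq_bigr => g _.
  rewrite /avg_cis !mulr_sumr; apply: eq_bigr => f _.
  rewrite -mulrA; congr (_ * _); rewrite phase cisD -mulrA; congr (_ * (_ * _)).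
  by rewrite fmorphV rmorphXn /= rmorph_nat.
(* The frequency zero; for any other [g] the vector [rr g] is nonzero with entries bounded by [D],
   and the hypothesis applies. *)
pose g0 : {ffun 'I_k -> 'I_D.*2.+1} := [ffun=> inord D].
have g0E i : (g0 i : nat) = D by rewrite ffunE inordK // ltnS -addnn leq_addl.
have rr0 i : rr g0 i = 0 by rewrite /rr g0E subrr.
have z0 j : z g0 j = 0.
  by rewrite /z big1 ?mulr0 // => i _; rewrite rr0 mul0r.
have bg0 : (\prod_i bcoef R D (g0 i))%:C%C * (cis (A g0) * avg_cis N (B g0)) =
    (\prod_(i < k) bcoef R D D)%:C%C :> C.
  have -> : A g0 = 0 by rewrite /A big1 // => i _; rewrite rr0 mulr0 mul0r.
  have -> : avg_cis N (B g0) = 1.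
    rewrite /avg_cis (eq_bigr (fun=> (w%:C%C : C))) => [|f _].
      by rewrite -rmorph_sum /= sumw.
    rewrite big1 => [|j _]; last by rewrite /B z0 mulr0 mul0r mul0rn.
    by rewrite cis0 div1r fmorphV rmorphXn /= rmorph_nat.
  rewrite cis0 !mulr1; congr (_%:C%C); apply: eq_bigr => i _.
  by rewrite g0E.
have sumb : \sum_(g : {ffun 'I_k -> 'I_D.*2.+1}) \prod_i bcoef R D (g i) = 1.
  rewrite -(bigA_distr_bigA (fun _ (l : 'I_D.*2.+1) => bcoef R D l)) /=.
  by rewrite big1 // => i _; exact: sum_bcoef.
have b0 (g : {ffun 'I_k -> 'I_D.*2.+1}) : 0 <= \prod_i bcoef R D (g i).
  by apply: prodr_ge0 => i _; exact: bcoef_ge0.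
have dist : `|(\sum_f P f * w)%:C%C - (\prod_(i < k) bcoef R D D)%:C%C| <= (2 / Q)%:C%C :> C.
  rewrite expand (bigD1 g0) //= bg0 addrAC subrr add0r.
  apply: le_trans (ler_norm_sum _ _ _) _.
  apply: (@le_trans _ _ (\sum_(g | g != g0) (\prod_i bcoef R D (g i) * (2 / Q))%:C%C)).
    apply: ler_sum => g gn.
    rewrite !normrM norm_cis mul1r rmorphM /=.
    rewrite [X in X * _]ger0_norm ?ler0c // ler_wpM2l ?ler0c //.
    have [||j hj] := H (rr g).
    - apply: contrapT => hn; case/eqP: gn; apply/ffunP => i; apply: ord_inj.
      rewrite g0E; apply: contrapT => hi; apply: hn; exists i.
      by rewrite /rr subr_eq0; apply/eqP => -[] /esym.
    - move=> i; rewrite /rr; have := ltn_ord (g i); move: (g i : nat) => l; lia.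
    have zj : Q <= `|z g j|.
      by rewrite /z normrM (ger0_norm (d0 j)) mulrC -intr_norm.
    apply: (@norm_avg_cis _ _ _ _ j) => //.
      rewrite /B !normrM normfV !normr_nat ler_pdivrMr //.
      by rewrite ler_pM2l // -normrM; exact: zN.

    rewrite /B (_ : _ / 2 = z g j / N%:R); last by field; rewrite pnatr_eq0.
    by rewrite normrM normfV normr_nat divfK // pnatr_eq0.
  rewrite -rmorph_sum /= lecR -mulr_suml ler_piMl ?divr_ge0 ?(ltW Q0) //.
  by rewrite -[leRHS]sumb [leRHS](bigD1 g0) //= lerDr.

rewrite -rmorphB /= normc_def /= expr0n addr0 sqrtr_sqr lecR in dist.
have low : (D.+1%:R ^+ k)^-1 <= \prod_(i < k) bcoef R D D.
  rewrite prodr_const card_ord -exprVn lerXn2r ?nnegrE ?invr_ge0 ?bcoef_ge0 //.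
  exact: bcoef_central.
have Dp : 0 < D.+1%:R ^+ k :> R by rewrite exprn_gt0.
have Q2 : 2 / Q = (D.+1%:R ^+ k)^-1 / 2 by rewrite /Q; field; rewrite gt_eqF.
have qq : q ^+ D < (D.+1%:R ^+ k)^-1 / 2.
  rewrite ltr_pdivlMr // -[ltRHS]mul1r ltr_pdivlMr //.
  by move: Dq; rewrite mulrCA mulrA.
rewrite ler_norml in dist; case/andP: dist => dist _.
move: dist; rewrite Q2; move: qq up low; set a := _^-1; set b := q ^+ D.
set s := \sum_f _; set e := \prod_(i < k) _; lra.
Qed.
End Kronecker2.

(** * Selective ultrafilters *)

Section Selectivity.
Local Open Scope nat_scope.

Lemma finite_nat_bounded (A : set nat) : finite_set A -> exists N, forall n, A n -> n < N.
Proof.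
move=> /finite_seqP[s ->]; exists (\max_(i <- s) i).+1 => n /= ns.
by rewrite ltnS; apply: (@leq_bigmax_seq _ s xpredT (fun i => i)).
Qed.

Lemma unbounded_infinite (A : set nat) :
  (forall N, exists2 n, A n & N <= n) -> infinite_set A.
Proof.
move=> H /finite_nat_bounded[N hN]; have [n An] := H N.
by rewrite leqNgt hN.
Qed.

Lemma infinite_unbounded (A : set nat) N : infinite_set A -> exists2 n, A n & N <= n.
Proof.
move=> iA; apply: contrapT => H; apply: iA; apply: sub_finite_set (finite_II N).
by move=> n An /=; rewrite ltnNge; apply/negP => Nn; apply: H; exists n.
Qed.

Section Selective.
Variable p : set_system nat.

Lemma ultraC A : UltraFilter p -> ~ p A -> p (~` A).
Proof. by move=> pU pA; have [] := in_ultra_setVsetC A pU. Qed.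

Lemma ultra_not0 : UltraFilter p -> ~ p set0.
Proof. by move=> pU; exact: filter_not_empty. Qed.

Lemma ultra_disjoint A B : UltraFilter p -> p A -> p B -> A `&` B !=set0.
Proof. by move=> pU pA pB; apply: (@filter_ex _ p _ (A `&` B)); exact: filterI. Qed.

Lemma free_point n : free_ultrafilter p -> p (~` [set n]).
Proof.
move=> [pU pf]; apply: ultraC => pn.
have : (set0 : set nat) n by rewrite -pf => A pA; have [m [/= <-]] := ultra_disjoint pU pn pA.
by [].
Qed.

Lemma free_tail N : free_ultrafilter p -> p [set n | N <= n].
Proof.
move=> fp; have pU := fp.1; elim: N => [|N IH].
  by apply: filterS filterT.
apply: filterS (filterI IH (free_point N fp)) => n [/= Nn /eqP nN].
by rewrite ltn_neqAle eq_sym nN.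
Qed.

Lemma free_infinite A : free_ultrafilter p -> p A -> infinite_set A.
Proof.
move=> fp pA; apply: unbounded_infinite => N.
by have [n [An /= nN]] := ultra_disjoint fp.1 pA (free_tail N fp); exists n.
Qed.

(** Selectivity applied to the fibres of [f]. A finite range needs its own argument, because a
    partition indexed by [nat] has infinitely many parts. *)
Lemma selective_const_or_inj (f : nat -> nat) : selective p ->
  exists2 B, p B & (exists c, forall n, B n -> f n = c) \/
    (forall m n, B m -> B n -> f m = f n -> m = n).
Proof.
move=> [fp sel]; have pU := fp.1.
have [fin|inf] := pselect (finite_set (range f)).
  have [s fs] := (finite_seqP _).1 fin.
  have [c pc] : exists c, p (f @^-1` [set c]).
    have : p (f @^-1` [set` s]).
      by apply: filterS filterT => n _ /=; have : range f (f n) by []; rewrite fs.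
    elim: s {fs} => [|a s IH] ps; first by case: (ultra_not0 pU); apply: filterS ps.
    have [pa|npa] := pselect (p (f @^-1` [set a])); first by exists a.
    apply: IH; apply: filterS (filterI ps (ultraC pU npa)) => n [/=].
    by rewrite inE => /orP[/eqP|].
  by exists (f @^-1` [set c]) => //; left; exists c.
have : [set: nat] #= range f.
  by apply: card_esym; apply/eq_card_nat => //; exact: sub_countable (card_image_le _ _) _.
move=> /card_set_bijP[g [gf gi gs]].
have part : partition setT (fun i => f @^-1` [set g i]) setT.
  split; first by apply/seteqP; split => // n _; have [i _ gi'] := gs (f n) (imageT f n); exists i.
    move=> i j _ _ [n [/= -> /gi]]; apply; by rewrite inE.
  by move=> i _; have [n _ fn] := gf i I; exists n.
have [[i pi]|[B pB BP]] := sel _ part.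
  by exists (f @^-1` [set g i]) => //; left; exists (g i).
exists B => //; right => m n Bm Bn fmn.
have [i _ gif] := gs (f m) (imageT f m).
have /pcard_leP[h] := BP i.
have hm : (B `&` (f @^-1` [set g i])) m by [].
have hn : (B `&` (f @^-1` [set g i])) n by split => //=; rewrite -fmn.
have := 'funS_h hm; have := 'funS_h hn; rewrite /= !ltnS !leqn0 => /eqP e1 /eqP e2.
by apply: ('inj_h); rewrite ?inE //; exact: (etrans e2 (esym e1)).
Qed.

(** Selective ultrafilters are P-points: the index of the first set missed by [n] is constant or
    injective on a set of [p], and a constant value [i] would contradict [p (X i)]. *)
Lemma selective_ppoint (X : nat -> set nat) : selective p -> (forall i, p (X i)) ->
  exists2 A, p A & forall i, exists N, forall n, A n -> N <= n -> X i n.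
Proof.
move=> sel pX; have [fp _] := sel; have pU := fp.1.
(* The value 0 means that [n] lies in every [X i], and [i + 1] that [X i] is the first set
   missed. *)
have f_ n : exists v, (v = 0 /\ forall i, X i n) \/
    (exists i, [/\ v = i.+1, ~ X i n & forall j, j < i -> X j n]).
  have [h|/existsNP[i hi]] := pselect (forall i, X i n); first by exists 0; left.
  have ex : exists i, `[< ~ X i n >] by exists i; exact/asboolP.
  case: (ex_minnP ex) => k /asboolP hk kmin.
  exists k.+1; right; exists k; split => // j jk; apply: contrapT => hj.
  by have := kmin j; rewrite leqNgt jk => /(_ (introT (asboolP _) hj)).
have [f fP] := choice f_.
have [B pB [[c cP]|inj]] := selective_const_or_inj f sel.
  case: c cP => [|c] cP.
    exists B => // i; exists 0 => n Bn _.
    by have [[_ //]|[j []]] := fP n; rewrite cP.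
  have [n [Bn Xn]] := ultra_disjoint pU pB (pX c).
  by have [[]|[j []]] := fP n; rewrite cP // => -[<-].
exists B => // i.
pose A := B `&` f @^-1` `I_i.+2.
have /finite_nat_bounded[N hN] : finite_set A.
  have fA : finite_set (f @` A).
    by apply: sub_finite_set (finite_II i.+2) => _ [n [_ /= fn] <-].
  suff e : f @` A #= A by rewrite -(eq_finite_set e).
  by apply: inj_card_eq => m n /set_mem[Bm _] /set_mem[Bn _]; exact: inj.
exists N => n Bn Nn; apply: contrapT => Xn.
suff /hN : A n by rewrite ltnNge Nn.
split => //=; have [[_ /(_ i)//]|[j [-> _ jX]]] := fP n.
by rewrite !ltnS leqNgt; apply/negP => /jX.
Qed.
End Selective.

(** Otherwise [g1] and [g2] send [p] and [q] to the same ultrafilter; inverting [g1] on [B] then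
    exhibits [p] as an image of [q]. *)
Lemma rk_separated (p q : set_system nat) (g1 g2 : nat -> nat) B :
  UltraFilter p -> UltraFilter q -> ~ rk_le p q -> p B ->
  (forall m n, B m -> B n -> g1 m = g1 n -> m = n) ->
  exists X Y, [/\ p X, q Y & forall x y, X x -> Y y -> g1 x <> g2 y].
Proof.
move=> pU qU npq pB inj; apply: contrapT => H; apply: npq.
have imp A : p (g1 @^-1` A) -> q (g2 @^-1` A).
  move=> pA; apply: contrapT => qA; apply: H.
  exists (g1 @^-1` A), (~` (g2 @^-1` A)); split => //; first exact: ultraC.
  by move=> x y /= Ax; apply: contra_not => <-.
have [s sP] : exists s : nat -> nat, forall n, B n -> s (g1 n) = n.
  have ex v : exists n, forall m, B m -> g1 m = v -> n = m.
    have [[n [Bn nv]]|no] := pselect (exists n, B n /\ g1 n = v).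
      by exists n => m Bm mv; apply: inj => //; rewrite nv.
    by exists 0 => m Bm mv; case: no; exists m.
  have [s sP] := choice ex; exists s => n Bn; exact: sP.
have dir A : p A -> q ((s \o g2) @^-1` A).
  move=> pA.
  have : q (g2 @^-1` (g1 @` (A `&` B))).
    by apply: imp; apply: filterS (filterI pA pB) => n ABn; exists n.
  by apply: filterS => y [n [An Bn] /= <-]; rewrite sP.
exists (s \o g2); apply/seteqP; split => A; first exact: dir.
move=> /= qA; apply: contrapT => /(ultraC pU)/dir qA'.
by have [n []] := ultra_disjoint qU qA qA'.
Qed.

(** Meant for indices of intervals: a whole interval lies strictly between two far ones, which
    leaves room for a jump by [h]. *)
Definition far a b := a.+1 < b \/ b.+1 < a.

Lemma finite_to_one_inj p (f : nat -> nat) : selective p ->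
  (forall N, exists K, forall n, f n <= N -> n <= K) ->
  exists2 B, p B & forall m n, B m -> B n -> f m = f n -> m = n.
Proof.
move=> sel H; have [B pB [[c cP]|inj]] := selective_const_or_inj f sel; last by exists B.
have [K hK] := H c.
have [n Bn] := infinite_unbounded K.+1 (free_infinite sel.1 pB).
by rewrite ltnNge hK // cP.
Qed.

(* The [m]-th block of the interval partition [i_(m+1) > max_(j <= i_m) h j]
   collapses to the point [m]; incomparability separates the images of the
   ultrafilters under this collapse and under its shifts by one. *)
Lemma selective_spread (p : nat -> set_system nat) (D : set nat) (h : nat -> nat) :
  (forall m, D m -> selective (p m)) ->
  (forall m m', D m -> D m' -> m <> m' -> ~ rk_le (p m) (p m')) ->
  exists B : nat -> set nat,
    [/\ forall m, D m -> p m (B m),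
        forall m m' n, D m -> D m' -> B m n -> B m' n -> m = m'
      & forall m m' n n', D m -> D m' -> B m n -> B m' n' -> n' < n -> h n' <= n].
Proof.
move=> sel rk.
pose H n := (\max_(j < n.+1) h j + n).+1.
pose i_ m := iter m H 0.
have iS m : i_ m < i_ m.+1 by rewrite /= ltnS leq_addl.
have imono a b : a <= b -> i_ a <= i_ b.
  by move=> /subnK <-; elim: (b - a) => // d IH; rewrite addSn (leq_trans IH) // ltnW.
have ige m : m <= i_ m by elim: m => // m IH; exact: leq_ltn_trans (iS m).
have pi_ n : exists m, i_ m <= n < i_ m.+1.
  elim: n => [|n [m /andP[m1 m2]]]; first by exists 0; rewrite /= ltnS.
  have [h1|h1] := ltnP n.+1 (i_ m.+1); first by exists m; rewrite h1 ltnW.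
  exists m.+1; rewrite h1; apply: leq_ltn_trans (iS m.+1); exact: m2.
have [pi piP] := choice pi_.
have pimono a b : a <= b -> pi a <= pi b.
  move=> ab; rewrite leqNgt; apply/negP => lt.
  have /andP[_ h1] := piP b; have /andP[h2 _] := piP a.
  have := leq_trans (leq_trans h1 (imono _ _ lt)) (leq_trans h2 ab); by rewrite ltnn.
have pifin N : exists K, forall n, pi n <= N -> n <= K.
  exists (i_ N.+1) => n nN; have /andP[_ h1] := piP n.
  by apply/ltnW/(leq_trans h1)/imono.
have pih n' n : (pi n').+1 < pi n -> h n' <= n.
  move=> lt; have /andP[h1 _] := piP n; have /andP[_ h2] := piP n'.
  apply: leq_trans h1; apply: leq_trans (imono _ _ lt).
  rewrite /= -/(i_ _) ltnW // ltnS; apply: leq_trans (leq_addr _ _).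
  by apply: (@leq_bigmax_cond _ xpredT (fun j : 'I_(_.+1) => h j) (Ordinal (ltnW h2 : n' < (i_ (pi n').+1).+1))).
have B1 m : exists B, D m -> p m B /\ forall x y, B x -> B y -> x <> y -> far (pi x) (pi y).
  have [Dm|] := pselect (D m); last by exists set0.
  have pU := (sel _ Dm).1.1.
  have [B pB inj] := finite_to_one_inj (sel _ Dm) pifin.
  (* Distinct interval indices of equal parity differ by at least 2, hence are far. *)
  have [c pc] : exists c, p m [set n | odd (pi n) = c].
    have [h1|/(ultraC pU) h1] := pselect (p m [set n | odd (pi n) = true]); first by exists true.
    by exists false; apply: filterS h1 => n /= /negP/negbTE.
  exists (B `&` [set n | odd (pi n) = c]) => _; split; first exact: filterI.
  move=> x y [Bx /= xc] [By /= yc] xy; have nxy : pi x <> pi y by move=> /(inj _ _ Bx By).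
  rewrite /far; have : odd (pi x) = odd (pi y) by rewrite xc yc.
  by move: nxy; move: (pi x) (pi y) => a b; lia.
have [B1_ B1P] := choice B1.
have sep1 j k : D j -> D k -> j <> k -> exists X Y, [/\ p j X, p k Y &
    forall x y, X x -> Y y -> far (pi x) (pi y)].
  move=> Dj Dk jk; have pU := (sel _ Dj).1.1; have qU := (sel _ Dk).1.1.
  have [B pB inj] := finite_to_one_inj (sel _ Dj) pifin.
  have injS x y : B x -> B y -> (pi x).+1 = (pi y).+1 -> x = y.
    by move=> ? ? [?]; exact: inj.
  have nrk := rk _ _ Dj Dk jk.
  (* Being far excludes three coincidences: equality of the interval indices, and equality after
     raising either of them by one. *)
  have [X1 [Y1 [pX1 qY1 F1]]] := rk_separated pi pU qU nrk pB inj.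
  have [X2 [Y2 [pX2 qY2 F2]]] := rk_separated (S \o pi) pU qU nrk pB inj.
  have [X3 [Y3 [pX3 qY3 F3]]] := @rk_separated _ _ (S \o pi) pi _ pU qU nrk pB injS.
  exists (X1 `&` (X2 `&` X3)), (Y1 `&` (Y2 `&` Y3)); split; [by do !apply: filterI.. |].
  move=> x y [x1 [x2 x3]] [y1 [y2 y3]]; rewrite /far.
  by move: (F1 _ _ x1 y1) (F2 _ _ x2 y2) (F3 _ _ x3 y3) => /=; lia.
have sep2 jk : exists XY : set nat * set nat, D jk.1 -> D jk.2 -> jk.1 <> jk.2 ->
    [/\ p jk.1 XY.1, p jk.2 XY.2 & forall x y, XY.1 x -> XY.2 y -> far (pi x) (pi y)].
  have [[Dj [Dk njk]]|no] := pselect (D jk.1 /\ D jk.2 /\ jk.1 <> jk.2).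
    by have [X [Y ?]] := sep1 _ _ Dj Dk njk; exists (X, Y).
  by exists (set0, set0) => *; case: no.
have [XY XYP] := choice sep2.
pose W k j := if `[< D k /\ D j /\ k <> j >] then (XY (k, j)).1 `&` (XY (j, k)).2 else setT.
have WP k j x y : D k -> D j -> k <> j -> W k j x -> W j k y -> far (pi x) (pi y).
  move=> Dk Dj kj; have jk := nesym kj; rewrite /W !asboolT // => -[x1 _] [_ y2].
  by have [_ _] := XYP (k, j) Dk Dj kj; apply.
have pW k j : D k -> p k (W k j).
  move=> Dk; have pU := (sel _ Dk).1.1; rewrite /W; case: asboolP => [[_ [Dj kj]]|_]; last exact: filterT.
  by apply: filterI; [have [] := XYP (k, j) Dk Dj kj|have [] := XYP (j, k) Dj Dk (nesym kj)].
have C_ k : exists CN : set nat * (nat -> nat), D k -> p k CN.1 /\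
    forall j n, CN.1 n -> CN.2 j <= n -> W k j n.
  have [Dk|] := pselect (D k); last by exists (set0, fun=> 0).
  have [A pA AP] := selective_ppoint (sel _ Dk) (fun j => pW k j Dk).
  by have [N NP] := choice AP; exists (A, N) => _; split.
have [CN CNP] := choice C_.
(* For [j < k] the separation of [x] in [B k] from [y] in [B j] works beyond a threshold on either
   side. The tail removed here puts [x] beyond its own threshold, and also far beyond that of [y],
   which settles the case where [y] is below its threshold. *)
pose B k := (CN k).1 `&` B1_ k `&`
  [set n | forall j, j < k -> (CN k).2 j <= n /\ (pi ((CN j).2 k)).+1 < pi n].
have pB k : D k -> p k (B k).
  move=> Dk; have pU := (sel _ Dk).1.1.
  apply: filterI; first by apply: filterI; [exact: (CNP k Dk).1|exact: (B1P k Dk).1].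
  suff [N hN] : exists N, forall n, N <= n -> forall j, j < k -> (CN k).2 j <= n /\ (pi ((CN j).2 k)).+1 < pi n.
    by apply: filterS (free_tail N (sel _ Dk).1); exact: hN.
  have ex j : exists N, forall n, N <= n -> (CN k).2 j <= n /\ (pi ((CN j).2 k)).+1 < pi n.
    have [K hK] := pifin (pi ((CN j).2 k)).+1.
    exists (maxn ((CN k).2 j) K.+1) => n; rewrite geq_max => /andP[-> Kn]; split=> //.
    by rewrite ltnNge; apply/negP => /hK; rewrite leqNgt Kn.
  have [N NP] := choice ex; exists (\max_(j < k) N j) => n Nn j jk.
  by apply: NP; apply: leq_trans Nn; apply: (@leq_bigmax_cond _ xpredT (fun j : 'I_k => N j) (Ordinal jk)).
have farlt k j x y : D k -> D j -> B k x -> B j y -> j < k -> far (pi x) (pi y).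
  move=> Dk Dj [[Cx B1x] Hx] [[Cy B1y] Hy] jk; have [h1 h2] := Hx _ jk.
  have [h3|h3] := leqP ((CN j).2 k) y.
    by apply: (WP k j) => //; [by move=> e; rewrite e ltnn in jk|exact: (CNP k Dk).2|exact: (CNP j Dj).2].
  by right; apply: leq_trans h2; rewrite !ltnS pimono // ltnW.
have farB k j x y : D k -> D j -> B k x -> B j y -> k <> j \/ x <> y -> far (pi x) (pi y).
  move=> Dk Dj Bx By; have [jk|jk|jk] := ltngtP j k.
  - by move=> _; exact: farlt jk.
  - by move=> _; have [] := farlt _ _ _ _ Dj Dk By Bx jk; [right|left].
  - subst j => -[//|xy]; case: Bx => -[_ Bx] _; case: By => -[_ By] _.
    exact: (B1P k Dk).2.
exists B; split => //.
- move=> m m' n Dm Dm' Bn Bn'; apply: contrapT => mm.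
  by have [] := farB _ _ _ _ Dm Dm' Bn Bn' (or_introl mm); lia.
- move=> m m' n n' Dm Dm' Bn Bn' lt; apply: pih.
  have /farB : m <> m' \/ n <> n' by right => e; rewrite e ltnn in lt.
  move=> /(_ Dm Dm' Bn Bn')[|//]; have := pimono _ _ (ltnW lt).
  by lia.
Qed.

End Selectivity.

(** * Words over the tree of generators *)

(* In [node k q w f] the sequence [f] lists letters, and [w n q] codes the [n]-th term
   of the [q]-th sequence of a [k]-tuple: pairs of a coefficient and an index into
   [f].  Values [q >= k] of the index are junk. *)
Inductive tree :=
  | leaf of set nat
  | block of nat & nat
  | node of nat & nat & (nat -> nat -> seq (int * nat)) & (nat -> tree).

HB.instance Definition _ := gen_eqMixin tree.
HB.instance Definition _ := gen_choiceMixin tree.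

Notation word := (seq (int * tree)).

Section Words.
Variable R : realType.
Implicit Types (x y : tree -> R) (v : word) (t : tree).

Definition ev x v : R := \sum_(a <- v) a.1%:~R * x a.2.
Definition coef t v : int := \sum_(a <- v) a.1 * (a.2 == t)%:R.
Definition letters v : seq tree := [seq a.2 | a <- v].
Definition l1 v : R := \sum_(a <- v) `|a.1|%:~R.

Lemma l1_ge0 v : 0 <= l1 v.
Proof. by apply: sumr_ge0 => a _; rewrite ler0z. Qed.

Lemma ev_close x y v (d : R) : (forall t, t \in letters v -> `|y t - x t| <= d) ->
  `|ev y v - ev x v| <= l1 v * d.
Proof.
move=> H; rewrite /ev -sumrB /l1 mulr_suml.
apply: (le_trans (ler_norm_sum _ _ _)).
rewrite big_seq [leRHS]big_seq; apply: ler_sum => a av.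
rewrite -mulrBr normrM intr_norm ler_wpM2l //.
by apply: H; apply: map_f.
Qed.

Lemma coef_notin t v : t \notin letters v -> coef t v = 0.
Proof.
move=> tv; rewrite /coef big_seq big1 // => a av.
case: eqP => [e|_]; last by rewrite mulr0.
by case/negP: tv; rewrite -e; exact: map_f.
Qed.

Lemma ev_coef x v (J : seq tree) : uniq J -> {subset letters v <= J} ->
  ev x v = \sum_(t <- J) (coef t v)%:~R * x t.
Proof.
move=> uJ sub; under eq_bigr do rewrite /coef rmorph_sum mulr_suml /=.
rewrite exchange_big /= /ev big_seq [RHS]big_seq; apply: eq_bigr => a av.
have aJ : a.2 \in J by apply: sub; exact: map_f.
rewrite (bigD1_seq a.2) //= eqxx mulr1 big1 ?addr0 // => t ta.
by rewrite eq_sym (negbTE ta) mulr0 mul0r.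
Qed.

Lemma evD x y v : ev (fun t => x t + y t) v = ev x v + ev y v.
Proof. by rewrite /ev -big_split /=; apply: eq_bigr => a _; rewrite mulrDr. Qed.

Definition good k (v : nat -> nat -> word) := forall r : 'I_k -> int,
  (exists i, r i != 0) -> forall g : tree -> int,
  finite_set [set n | forall t, \sum_(q < k) r q * coef t (v n q) = g t].

(** Pigeonhole: only finitely many coefficient functions are supported on [F] and bounded by [C],
    and goodness lets each occur finitely often. *)
Lemma good_escape k (v : nat -> nat -> word) (F : seq tree) (C : nat) (r : 'I_k -> int) :
  good k v -> (exists i, r i != 0) ->
  finite_set [set n | forall t, let c := \sum_(q < k) r q * coef t (v n q) in
    `|c| <= C%:Z /\ (t \notin F -> c = 0)].
Proof.
move=> gd r0; pose rc n t : int := \sum_(q < k) r q * coef t (v n q).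
pose code n : {ffun 'I_(size F) -> 'I_(C.*2).+1} :=
  [ffun i : 'I_(size F) => inord (absz (rc n (nth (leaf set0) F i) + C%:Z))].
set A := [set n | _].
have -> : A = \bigcup_c (A `&` code @^-1` [set c]).
  by apply/seteqP; split => [n An|n [c _ []]//]; exists (code n).
apply: bigcup_finite => [|c _]; first exact: finite_finset.
have [->|/set0P[n0 [An0 cn0]]] := eqVneq (A `&` code @^-1` [set c]) set0; first exact: finite_set0.
apply: sub_finite_set (gd r r0 (rc n0)) => n [An cn] t.
have [h1 h2] := An t; have [h3 h4] := An0 t.
have [tF|tF] := boolP (t \in F); last by rewrite h2 // /rc h4.
have iF : (index t F < size F)%N by rewrite index_mem.
have /(congr1 (fun f : {ffun _ -> _} => val (f (Ordinal iF)))) : code n = code n0 by rewrite cn cn0.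
move: h1 h3; rewrite !ffunE /= !nth_index // -/(rc n t) -/(rc n0 t).
move: (rc n t) (rc n0 t) => a b ha hb.
by rewrite !inordK; lia.
Qed.

Lemma word_kronecker k (eps : R) : 0 < eps ->
  exists (D : nat) (Q : R), 0 < Q /\
  forall (v : nat -> word) (F : seq tree) x (d : R) (th : nat -> R), 0 < d ->
  (forall r : 'I_k -> int, (exists i, r i != 0) -> (forall i, `|r i| <= D%:Z) ->
     exists t, let c := \sum_(q < k) r q * coef t (v q) in
       (Q <= `|c|%:~R * d) \/ (t \notin F /\ c != 0)) ->
  exists y, [/\ forall t, t \in F -> `|y t - x t| <= d,
    forall t, (forall q, (q < k)%N -> t \notin letters (v q)) -> y t = x t
    & forall q, (q < k)%N -> `|sin (ev y (v q) - th q)| < eps].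
Proof.
move=> e0; have [D [Q [Q0 H]]] := kronecker_box k e0; exists D, Q; split => //.
move=> v F x d th d0 hyp.
pose J := undup (flatten [seq letters (v q) | q <- iota 0 k]).
have uJ : uniq J by exact: undup_uniq.
have subJ q : (q < k)%N -> {subset letters (v q) <= J}.
  move=> qk t tq; rewrite mem_undup; apply/flattenP; exists (letters (v q)) => //.
  by apply: map_f; rewrite mem_iota.
pose t0 := leaf set0.
pose c (i : 'I_k) (j : 'I_(size J)) := coef (nth t0 J j) (v i).
(* A letter outside [F] may move by at least [Q], so there any nonzero integer coefficient is
   already large enough. *)
pose dd (j : 'I_(size J)) := if nth t0 J j \in F then d else Num.max d Q.
have dd0 j : 0 <= dd j by rewrite /dd; case: ifP => _; rewrite ?le_max ltW.
have [|y [y1 y2]] := H _ c (fun j => x (nth t0 J j)) dd (fun i => th i) dd0.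
  move=> r r0 rD; have [t /= ht] := hyp r r0 rD.
  have tJ : t \in J.
    apply: contraT => tJ.
    have c0 : \sum_(q < k) r q * coef t (v q) = 0.
      rewrite big1 // => q _; rewrite coef_notin ?mulr0 //.
      by apply: contra tJ; exact: subJ.
    move: ht; rewrite c0 eqxx normr0 mul0r => -[|[]//].
    by rewrite leNgt Q0.
  have iJ : (index t J < size J)%N by rewrite index_mem.
  exists (Ordinal iJ); rewrite /dd /c /= nth_index //.
  set s := \sum_(q < k) _ in ht *.
  case: ht => [h|[tF s0]].
    apply: le_trans h _; rewrite ler_wpM2l ?ler0z //.
    by case: ifP => // _; rewrite le_max lexx.
  rewrite (negbTE tF); apply: (@le_trans _ _ (1 * Q)); first by rewrite mul1r.
  rewrite ler_pM // ?(ltW Q0) ?le_max ?lexx ?orbT //.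
  by rewrite ler1z -gtz0_ge1 normr_gt0.
pose y' t := if insub (index t J) is Some j then y j else x t.
have y'J (j : 'I_(size J)) : y' (nth t0 J j) = y j.
  by rewrite /y' index_uniq // valK.
have y'N t : t \notin J -> y' t = x t.
  by move=> tJ; rewrite /y' insubN // -leqNgt leqNgt index_mem.
exists y'; split => [t tF|t tJ|q qk].
- have [tJ|/y'N->] := boolP (t \in J); last by rewrite subrr normr0 ltW.
  have iJ : (index t J < size J)%N by rewrite index_mem.
  have := y1 (Ordinal iJ); have := y'J (Ordinal iJ).
  by rewrite /dd /= nth_index // tF => ->.
- apply: y'N; rewrite mem_undup; apply/flattenP => -[s /mapP[q]].
  by rewrite mem_iota /= add0n => qk -> ; apply/negP; exact: tJ.
- have := y2 (Ordinal qk); rewrite (ev_coef _ uJ (subJ _ qk)) /=.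
  rewrite (big_nth t0) big_mkord; congr (`|sin (_ - _)| < _).
  by apply: eq_bigr => j _; rewrite y'J.
Qed.

(* A block has [M.+1] letters, so [k <= M] linear conditions leave a nonzero
   direction along which it can be moved freely. *)
Lemma shift_block M k (v : nat -> word) y b (tau : nat -> R) : (k <= M)%N ->
  exists y', [/\ forall t, (forall i, (i <= M)%N -> t <> block i b) -> y' t = y t,
    forall q, (q < k)%N -> ev y' (v q) = ev y (v q)
    & exists2 i, (i <= M)%N & `|sin (y' (block i b) - tau i)| = 1].
Proof.
move=> kM.
pose A : 'M[R]_(M.+1, k) := \matrix_(i, q) (coef (block i b) (v q))%:~R.
have : kermx A != 0.
  by rewrite kermx_eq0 /row_free neq_ltn (leq_ltn_trans (rank_leq_col A)).
move=> /rowV0Pn[d /sub_kermxP dA d0].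
have [i di] : exists i, d 0 i != 0.
  apply: contrapT => H; case/eqP: d0; apply/rowP => i; rewrite mxE.
  by apply: contrapT => /eqP di; apply: H; exists i.
(* Moves the letter [block i b] to [tau i + pi / 2], the point farthest from [tau i]. *)
pose s := (pi / 2 + tau i - y (block i b)) / d 0 i.
pose z t : R := \sum_(j < M.+1) (s * d 0 j) * (t == block j b)%:R.
have zi (j : 'I_M.+1) : z (block j b) = s * d 0 j.
  rewrite /z (bigD1 j) //= eqxx mulr1 big1 ?addr0 // => l lj.
  case: eqP => [[e]|_]; last by rewrite mulr0.
  by case/eqP: lj; apply: val_inj.
exists (fun t => y t + z t); split.
- move=> t ht; rewrite /z big1 ?addr0 // => j _.
  case: eqP => [e|_]; last by rewrite mulr0.
  by case: (ht j) => //; rewrite -ltnS ltn_ord.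
- move=> q qk; rewrite evD -[RHS]addr0; congr (_ + _).
  have := congr1 (fun B : 'rV[R]_k => s * B 0 (Ordinal qk)) dA; rewrite !mxE mulr0 => <-.
  rewrite mulr_sumr /ev /z; under eq_bigr do rewrite mulr_sumr.
  rewrite exchange_big; apply: eq_bigr => j _; rewrite mxE /coef rmorph_sum !mulr_sumr /=.
  by apply: eq_bigr => a _; rewrite rmorphM /= rmorph_nat; ring.
- exists i; first by rewrite -ltnS ltn_ord.
  rewrite zi /s divfK // (_ : _ - _ = pi / 2); last by ring.
  by rewrite sin_pihalf normr1.
Qed.

Lemma shift_blocks M k (v : nat -> word) y (tau : nat -> R) (bs : seq nat) : (k <= M)%N ->
  exists y', [/\ forall t, (forall i b, (i <= M)%N -> b \in bs -> t <> block i b) -> y' t = y t,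
    forall q, (q < k)%N -> ev y' (v q) = ev y (v q)
    & forall b, b \in bs -> exists2 i, (i <= M)%N & `|sin (y' (block i b) - tau i)| = 1].
Proof.
move=> kM; elim: bs => [|b bs [y1 [h1 h2 h3]]]; first by exists y.
have [y2 [g1 g2 g3]] := shift_block v y1 b tau kM.
exists y2; split.
- move=> t ht; rewrite g1 ?h1 //.
    by move=> i c iM cb; apply: ht; rewrite // inE cb orbT.
  by move=> i iM; apply: ht; rewrite // inE eqxx.
- by move=> q qk; rewrite g2 ?h2.
- move=> c; rewrite inE; have [-> _|cb /= /h3[i iM hi]] := eqVneq c b; first exact: g3.
  exists i => //; rewrite g1 // => j jM [_ e].
  by rewrite e eqxx in cb.
Qed.

End Words.

(** * Characters satisfying countably many limit laws *)

Section Construction.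
Variables (R : realType) (M : nat) (D : set nat) (k : nat -> nat).
Variables (v : nat -> nat -> nat -> word) (nd : nat -> nat -> tree).
Variable pp : nat -> set_system nat.
Hypothesis kM : forall m, D m -> (k m <= M)%N.
Hypothesis gd : forall m, D m -> good (k m) (v m).
Hypothesis sel : forall m, D m -> selective (pp m).
Hypothesis rk : forall m m', D m -> D m' -> m <> m' -> ~ rk_le (pp m) (pp m').
Implicit Types (x y : tree -> R) (t : tree).

(** [F i] collects the finitely many letters that concern the first [i] laws at the first [i]
    indices. Blocks enter as a whole, so testing [block 0 b] decides for all their letters. *)
Lemma exists_stages (F0 : seq tree) : exists F : nat -> seq tree,
  [/\ {subset F0 <= F 0%N}, forall i j, (i <= j)%N -> {subset F i <= F j},
      forall i m q, (m < i)%N -> (q < k m)%N -> nd m q \in F i,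
      forall i m n q, (m < i)%N -> (n < i)%N -> (q < k m)%N ->
        {subset letters (v m n q) <= F i}
    & forall i b j j', (j' <= M)%N -> block j b \in F i -> block j' b \in F i].
Proof.
pose bl t := t :: if t is block _ b then [seq block j b | j <- iota 0 M.+1] else [::].
pose base i := F0 ++ flatten [seq [seq nd m q | q <- iota 0 (k m)] | m <- iota 0 i]
  ++ flatten [seq flatten [seq flatten [seq letters (v m n q) | q <- iota 0 (k m)]
      | n <- iota 0 i] | m <- iota 0 i].
pose F i := flatten [seq bl t | t <- base i].
have blb a c j : (j <= M)%N -> block j c \in bl (block a c).
  move=> jM; rewrite /bl inE; apply/orP; right.
  by apply: (map_f (block^~ c)); rewrite (mem_iota 0 M.+1).
have baseF i : {subset base i <= F i}.
  by move=> t ti; apply/flattenP; exists (bl t); rewrite ?map_f // inE eqxx.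
have basemono i j : (i <= j)%N -> {subset base i <= base j}.
  move=> ij t; rewrite !mem_cat => /or3P[->//|/flattenP[_ /mapP[m mi ->] tm]|].
    apply/or3P; apply: Or32; apply/flattenP; eexists; last exact: tm.
    by apply: map_f; move: mi; rewrite !mem_iota !add0n => /leq_trans; apply.
  move=> /flattenP[_ /mapP[m mi ->] /flattenP[_ /mapP[n ni ->] tm]].
  apply/or3P; apply: Or33; apply/flattenP; eexists.
    by apply: map_f; move: mi; rewrite !mem_iota !add0n => /leq_trans; apply.
  apply/flattenP; eexists; last exact: tm.
  by apply: (map_f (fun n => flatten [seq letters (v m n q) | q <- iota 0 (k m)]));
    move: ni; rewrite !mem_iota !add0n => /leq_trans; apply.
exists F; split.
- by move=> t tF; apply: baseF; rewrite mem_cat tF.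
- move=> i j ij t /flattenP[_ /mapP[s si ->] ts]; apply/flattenP; exists (bl s) => //.
  by apply: map_f; exact: basemono ij _ si.
- move=> i m q mi qk; apply: baseF; rewrite !mem_cat; apply/or3P; apply: Or32.
  apply/flattenP; exists [seq nd m q | q <- iota 0 (k m)]; apply: map_f.
    by rewrite mem_iota.
  by rewrite mem_iota.
- move=> i m n q mi ni qk t tv; apply: baseF; rewrite !mem_cat; apply/or3P; apply: Or33.
  apply/flattenP; eexists; first by apply: map_f; rewrite mem_iota; exact: mi.
  apply/flattenP; eexists.
    by apply: (map_f (fun n => flatten [seq letters (v m n q) | q <- iota 0 (k m)])); rewrite mem_iota; exact: ni.
  apply/flattenP; eexists; last exact: tv.
  by apply: map_f; rewrite mem_iota.
- move=> i b j j' j'M /flattenP[_ /mapP[s si ->]].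
  rewrite inE => /orP[/eqP sE|].
    apply/flattenP; exists (bl s); first exact: map_f.
    by rewrite -sE blb.
  case: s si => // a c si /mapP[l _ [_ cE]]; apply/flattenP; exists (bl (block a c)); first exact: map_f.
  by rewrite cE blb.
Qed.

Definition stepable (F : seq tree) (d : R) m n := forall x (th : nat -> R),
  exists y, [/\ forall t, t \in F -> `|y t - x t| <= d,
    forall t, (forall q, (q < k m)%N -> t \notin letters (v m n q)) -> y t = x t
    & forall q, (q < k m)%N -> `|sin (ev y (v m n q) - th q)| < d].

(** [word_kronecker] asks about the finitely many [r] bounded by [E] only, and by [good_escape] each
    of them fails at finitely many [n]. The function [g] stores [r + E] to make this set of [r] a
    finite type. *)
Lemma eventually_stepable F d m : 0 < d -> D m ->
  exists N, forall n, (N <= n)%N -> stepable F d m n.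
Proof.
move=> d0 Dm; have [E [Q [Q0 H]]] := word_kronecker (k m) d0.
pose C := (Num.truncn (Q / d)).+1.
pose r_ (g : {ffun 'I_(k m) -> 'I_(E.*2).+1}) (q : 'I_(k m)) : int := (g q : nat)%:Z - E%:Z.
pose bad g := [set n | (exists i, r_ g i != 0) /\ forall t,
  let c := \sum_(q < k m) r_ g q * coef t (v m n q) in `|c| <= C%:Z /\ (t \notin F -> c = 0)].
have : finite_set (\bigcup_g bad g).
  apply: bigcup_finite => [|g _]; first exact: finite_finset.
  have [r0|r0] := pselect (exists i, r_ g i != 0); last first.
    by apply: (sub_finite_set _ (finite_set0 nat)) => n [].
  by apply: sub_finite_set (good_escape F C (gd Dm) r0) => n [].
move=> /finite_nat_bounded[N hN]; exists N => n Nn x th.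
have [|y [y1 y2 y3]] := H (fun q => v m n q) F x d th d0; last by exists y.
move=> r [i ri] rE; apply: contrapT => hno.
pose g : {ffun 'I_(k m) -> 'I_(E.*2).+1} := [ffun q => inord (absz (r q + E%:Z))].
have rg q : r_ g q = r q.
  by rewrite /r_ ffunE inordK; have := rE q; move: (r q) => a; lia.
suff /hN : (\bigcup_g bad g) n by rewrite ltnNge Nn.
exists g => //; split; first by exists i; rewrite rg.
move=> t /=; under eq_bigr do rewrite rg.
set c := \sum_(q < k m) _; split.
  have : `|c|%:~R * d < Q.
    by rewrite ltNge; apply/negP => h; apply: hno; exists t; left.
  rewrite -ltr_pdivlMr // => /lt_trans/(_ (real_truncnS_gt (num_real _))).
  by rewrite -/C pmulrn ltr_int => /ltW.
move=> tF; apply/eqP; apply: contraT => c0; exfalso; apply: hno; exists t; right.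
by split.
Qed.

Lemma ler_sum_ord (F : nat -> R) n i : (forall j, 0 <= F j) -> (i < n)%N ->
  F i <= \sum_(j < n) F j.
Proof.
by move=> F0 lt; rewrite (bigD1 (Ordinal lt)) //= lerDl sumr_ge0.
Qed.

Lemma l1_bound i : exists L : R, 0 < L /\ forall m n q, (m <= i)%N -> (n <= i)%N -> (q < k m)%N ->
  l1 R (v m n q) <= L.
Proof.
have S0 m n : 0 <= \sum_(q < k m) l1 R (v m n q) by apply: sumr_ge0 => q _; exact: l1_ge0.
have S1 m : 0 <= \sum_(n < i.+1) \sum_(q < k m) l1 R (v m n q) by apply: sumr_ge0.
exists (1 + \sum_(m < i.+1) \sum_(n < i.+1) \sum_(q < k m) l1 R (v m n q)); split.
  by rewrite ltr_pwDl ?ltr01 // sumr_ge0.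
move=> m n q; rewrite -(ltnS m) -(ltnS n) => mi ni qk.
apply: le_trans (@ler_sum_ord (fun q => l1 R (v m n q)) _ _ (fun q => l1_ge0 R _) qk) _.
apply: le_trans (@ler_sum_ord (fun n => \sum_(q < k m) l1 R (v m n q)) _ _ (S0 m) ni) _.
apply: le_trans (@ler_sum_ord (fun m => \sum_(n < i.+1) \sum_(q < k m) l1 R (v m n q)) _ _ S1 mi) _.
by rewrite lerDr.
Qed.

(** Halving keeps the total later movement of a letter below twice the current radius. The last
    clause keeps the resulting error on words, amplified by their [l1] norm, below twice the
    preceding radius. *)
Lemma exists_radii (d0 : R) : 0 < d0 -> exists d : nat -> R,
  [/\ d 0%N = d0, forall i, 0 < d i, forall i, d i.+1 * 2 <= d i
    & forall i m n q, (m <= i)%N -> (n <= i)%N -> (q < k m)%N -> l1 R (v m n q) * (2 * d i.+1) <= 2 * d i].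
Proof.
move=> d00; have [L LP] := choice l1_bound.
pose d := fix d i := if i is i'.+1 then d i' / 2 / (1 + L i') else d0.
have Lp i : 0 < L i by have [] := LP i.
have dp i : 0 < d i.
  by elim: i => //= i IH; rewrite !divr_gt0 // addr_gt0.
exists d; split => // [i|i m n q mi ni qk] /=.
  rewrite mulrAC divfK ?pnatr_eq0 // ler_pdivrMr ?addr_gt0 // ler_peMr ?(ltW (dp i)) //.
  by rewrite lerDl ltW.
have [_ /(_ m n q mi ni qk) h] := LP i.
have -> : l1 R (v m n q) * (2 * (d i / 2 / (1 + L i))) = (l1 R (v m n q) / (1 + L i)) * d i.
  by field; rewrite gt_eqF // addr_gt0.
apply: ler_pM => //; rewrite ?divr_ge0 ?l1_ge0 ?addr_ge0 ?(ltW (Lp i)) ?(ltW (dp i)) //.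
rewrite ler_pdivrMr ?addr_gt0 //; apply: le_trans h _.
by have := Lp i; lra.
Qed.

Lemma limit_construction (F0 : seq tree) x0 (tau : nat -> R) (d0 : R) : 0 < d0 ->
  exists x, [/\ forall t, t \in F0 -> `|x t - x0 t| <= 2 * d0,
    exists N, forall b, (N <= b)%N ->
      exists2 i, (i <= M)%N & 1 - 2 * d0 <= `|sin (x (block i b) - tau i)|
    & forall m, D m -> forall e, 0 < e -> pp m [set n | forall q, (q < k m)%N ->
        `|sin (ev x (v m n q) - x (nd m q))| < e]].
Proof.
move=> d00; have [F [F0F Fmono Fnd Fv Fb]] := exists_stages F0.
have [d [dz dp dhalf dl1]] := exists_radii d00.
have dmono i j : (i <= j)%N -> d j <= d i.
  move=> /subnK <-; elim: (j - i)%N => // l IH; rewrite addSn; apply: le_trans IH.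
  by have := dhalf (l + i)%N; have := dp (l + i).+1; lra.
have h_ i : exists N, forall m, (m < i)%N -> D m -> forall n, (N <= n)%N -> stepable (F i) (d i) m n.
  have ex m : exists N, D m -> forall n, (N <= n)%N -> stepable (F i) (d i) m n.
    have [Dm|nD] := pselect (D m); last by exists 0%N.
    by have [N hN] := eventually_stepable (F i) (dp i) Dm; exists N.
  have [N NP] := choice ex; exists (\max_(m < i) N m)%N => m mi Dm n Nn.
  apply: NP => //; apply: leq_trans Nn.
  exact: (@leq_bigmax_cond _ xpredT (fun j : 'I_i => N j) (Ordinal mi)).
have [h hP] := choice h_.
(* After acting at [n'] the construction is at stage [n' + 1], hence the shift of [h]: the next
   acting index is at least [h n'.+1]. The bound added in [B] serves the case where a law acts at
   stage [m + 1] instead. *)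
have [B0 [pB0 B0disj B0spread]] := selective_spread (h \o S) sel rk.
pose B m := B0 m `&` [set n | (maxn (h m.+1) m.+1 <= n)%N].
have pB m : D m -> pp m (B m).
  move=> Dm; have pU := (sel Dm).1.1.
  by apply: filterI; [exact: pB0|exact: free_tail (sel Dm).1].
(* A state consists of a valuation and a stage [I], the letters of [F I] being committed to arcs of
   radius [2 * d I]. At [j] in [B m] law [m] acts at stage [i = max I (m + 1)], so that its limit
   letters are in [F i], and the words are moved to the values these letters had before the step. *)
pose trans j (s s' : (tree -> R) * nat) :=
  ((forall m, D m -> ~ B m j) /\ s' = s) \/
  exists m, [/\ D m, B m j, s'.2 = j.+1, (maxn s.2 m.+1 <= j)%N
    & let i := maxn s.2 m.+1 in
    [/\ forall t, t \in F i -> `|s'.1 t - s.1 t| <= d i,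
      forall t, t \notin F j.+1 -> s'.1 t = s.1 t,
      forall q, (q < k m)%N -> `|sin (ev s'.1 (v m j q) - s.1 (nd m q))| < d i
    & forall b, block 0 b \notin F i -> block 0 b \in F j.+1 ->
      exists2 i, (i <= M)%N & `|sin (s'.1 (block i b) - tau i)| = 1]].
pose pre j (s : (tree -> R) * nat) := s.2 = 0%N \/
  exists m n, [/\ D m, B m n, s.2 = n.+1 & (n < j)%N].
have step js : exists s', pre js.1 js.2 -> trans js.1 js.2 s'.
  case: js => j s; have [[m [Dm Bmj]]|no] := pselect (exists m, D m /\ B m j); last first.
    by exists s => _; left; split => // m Dm Bm; apply: no; exists m.
  have [prs|np] := pselect (pre j s); last by exists s.
  pose i := maxn s.2 m.+1.
  have [Bm0 /=] := Bmj; rewrite geq_max => /andP[hmj mj].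
  have ij : (i <= j)%N.
    rewrite geq_max mj andbT; case: prs => [->//|[m' [n [_ _ -> ->]]]] //.
  have hij : (h i <= j)%N.
    rewrite /i; case: (leqP s.2 m.+1) => // lt; case: prs => [e|[m' [n [Dm' [Bn _] e nj]]]].
      by rewrite e in lt.
    by rewrite e; exact: (B0spread m m').
  have mi : (m < i)%N by rewrite leq_max ltnSn orbT.
  have [y [y1 y2 y3]] := hP i m mi Dm j hij s.1 (fun q => s.1 (nd m q)).
  pose ok t := if t is block _ b then (block 0 b \notin F i) && (block 0 b \in F j.+1) else false.
  pose bs := flatten [seq if t is block _ b then [:: b] else [::] | t <- F j.+1 & ok t].
  have bsP b : b \in bs <-> (block 0 b \notin F i) /\ (block 0 b \in F j.+1).
    split; last first.
      move=> [b1 b2]; apply/flattenP; exists [:: b]; last by rewrite inE.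
      apply/mapP; exists (block 0 b) => //; by rewrite mem_filter /= b1 b2.
    move=> /flattenP[_ /mapP[t tF ->]]; move: tF; rewrite mem_filter.
    by case: t => //= a c /andP[/andP[c1 c2] _]; rewrite inE => /eqP ->.
  have [y' [z1 z2 z3]] := shift_blocks (v m j) y tau bs (kM Dm).
  exists (y', j.+1) => _; right; exists m; split => //; split => /=.
  - move=> t tF; rewrite z1; first exact: y1.
    move=> l b lM /bsP[b1 _] e; case/negP: b1; apply: (Fb _ _ l) => //.
    by rewrite -e.
  - move=> t tF; rewrite z1 ?y2 //.
      move=> q qk; apply: contra tF; apply: Fv => //; rewrite ltnS ltnW //.
    move=> l b lM /bsP[_ b2] e; case/negP: tF; rewrite e.
    exact: Fb b2.
  - by move=> q qk; rewrite z2 //; exact: y3.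
  - by move=> b b1 b2; apply: z3; apply/bsP.
have [nx nxP] := choice step.
(* A block outside [F 0] starts at the farthest point from [tau], so it is harmless as long as no
   step touches it. *)
pose x1 t := if t is block i b then (if block i b \in F 0%N then x0 t else tau i + pi / 2) else x0 t.
pose st := fix st j := if j is j'.+1 then nx (j', st j') else (x1, 0%N).
have stpre j : pre j (st j) /\ trans j (st j) (st j.+1).
  have imp l : pre l (st l) -> trans l (st l) (st l.+1) by exact: nxP (l, st l).
  suff pj : pre j (st j) by split => //; exact: imp.
  elim: j => [|j IH]; first by left.
  have [[_ ->]|[m [Dm Bm e _ _]]] := imp _ IH.
    case: IH => [e|[m [n [? ? ? nj]]]]; first by left.
    by right; exists m, n; split => //; exact: ltnW.
  by right; exists m, j.
have st0 : st 0%N = (x1, 0%N) by [].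
clearbody st; clear step nxP nx.
pose X j := (st j).1; pose I j := (st j).2.
have I0 : I 0%N = 0%N by rewrite /I st0.
have tr j : trans j (st j) (st j.+1) := (stpre j).2.
have Ile j : (I j <= j)%N.
  by rewrite /I; case: (stpre j).1 => [->//|[m [n [_ _ -> ]]]].
have Imono i j : (i <= j)%N -> (I i <= I j)%N.
  move=> /subnK <-; elim: (j - i)%N => // l IH; rewrite addSn; apply: leq_trans IH _.
  rewrite /I; case: (tr (l + i)%N) => [[_ ->//]|[m [_ _ -> _ _]]].
  by apply: leq_trans (Ile _) _.
have notF t j : t \notin F (I j) -> X j t = x1 t.
  elim: j => [|j IH]; rewrite /X /I; first by rewrite st0.
  case: (tr j) => [[_ ->]|[m [_ _ e _ [_ keep _ _]]]]; first exact: IH.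
  rewrite e => tF; rewrite keep //; apply: IH; apply: contra tF; apply: Fmono.
  exact: leqW (Ile j).
(* Telescoping: a step at stage [i] moves committed letters by at most [d i], which is at most
   [2 * d i - 2 * d j.+1] because the next radius is at most half as large. *)
have close j j' t : (j <= j')%N -> t \in F (I j) ->
    `|X j' t - X j t| <= 2 * d (I j) - 2 * d (I j').
  move=> /subnK <- tF; elim: (j' - j)%N => [|l IH]; first by rewrite add0n !subrr normr0.
  rewrite addSn; have jl : (j <= l + j)%N by exact: leq_addl.
  move: (l + j)%N jl IH => a ja IH; rewrite /X /I.
  case: (tr a) => [[_ ->]//|[m [_ _ e ia [near _ _ _]]]].
  have tF' : t \in F (maxn (st a).2 m.+1).
    by apply: Fmono tF; rewrite leq_max Imono.
  move: ia (near t tF'); set i := maxn _ _ => ia h1.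
  have h2 : d (I a) >= d i by apply: dmono; rewrite leq_max leqnn.
  have h3 : d a.+1 * 2 <= d i.
    by apply: le_trans (dhalf a) _; exact: dmono.
  have h4 : `|(st a.+1).1 t - X j t| <= `|(st a.+1).1 t - (st a).1 t| + `|X a t - X j t|.
    by rewrite -[X in `|X|](subrKA (X a t)) ler_normD.
  by rewrite e; move: IH h1 h2 h3 h4; rewrite /I; lra.
have x1b i b : block i b \notin F 0%N -> `|sin (x1 (block i b) - tau i)| = 1.
  by move=> /negbTE bF; rewrite /x1 bF addrAC subrr add0r sin_pihalf normr1.
have sin_near (a b c : R) : `|sin (a - c)| - `|b - a| <= `|sin (b - c)|.
  rewrite lerBlDr (_ : a - c = (b - c) + (a - b)); last by ring.
  by apply: le_trans (norm_sinD _ _) _; rewrite lerD2l distrC norm_sin_le.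
(* The term [2 * d (I j)] pays for the movement still to come; in the limit [1 - 2 * d0] remains. *)
have avoid j b : block 0 b \notin F 0%N ->
    exists2 i, (i <= M)%N & 1 - 2 * d0 + 2 * d (I j) <= `|sin (X j (block i b) - tau i)|.
  move=> b0.
  have le1 l : 1 - 2 * d0 + 2 * d (I l) <= 1.
    by have := dmono 0%N (I l) (leq0n _); rewrite dz; lra.
  have fresh l : block 0 b \notin F (I l) ->
      exists2 i, (i <= M)%N & 1 - 2 * d0 + 2 * d (I l) <= `|sin (X l (block i b) - tau i)|.
    by move=> bl; exists 0%N => //; rewrite notF // x1b.
  elim: j => [|j IH]; first by apply: fresh; rewrite I0.
  have [bj|bj] := boolP (block 0 b \in F (I j.+1)); last exact: fresh.
  move: bj; rewrite /X /I.
  case: (tr j) => [[_ ->]//|[m [_ _ e ij [near _ _ new]]]] bj.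
  move: ij near new; set l := maxn _ _ => ij near new.
  have [bl|bl] := boolP (block 0 b \in F l); last first.
    rewrite e in bj; have [i iM hi] := new b bl bj; exists i => //.
    by rewrite hi; exact: le1 j.+1.
  have [i iM hi] := IH; exists i => //.
  have h1 := near (block i b) (Fb _ _ _ _ iM bl).
  have h2 : d (I j) >= d l by apply: dmono; rewrite leq_max leqnn.
  have h3 : d j.+1 * 2 <= d l.
    by apply: le_trans (dhalf j) _; exact: dmono.
  rewrite e; have := sin_near (X j (block i b)) ((st j.+1).1 (block i b)) (tau i).
  by move: hi h1 h2 h3; rewrite /X /I; lra.
(* The lower ends of nested arcs; their supremum lies in all the arcs. A letter that is never
   committed keeps its initial value. *)
pose S t : set R := [set r | exists2 j, t \in F (I j) & r = X j t - 2 * d (I j)].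
pose x t := if `[< exists j, t \in F (I j) >] then sup (S t) else x1 t.
have xX t j : t \in F (I j) -> `|x t - X j t| <= 2 * d (I j).
  move=> tF; rewrite /x asboolT; last by exists j.
  have Sle a b : t \in F (I a) -> t \in F (I b) -> X a t - 2 * d (I a) <= X b t + 2 * d (I b).
    move=> ta tb; have [ab|/ltnW ba] := leqP a b.
      by have := close _ _ _ ab ta; rewrite ler_norml; have := dp (I a); have := dp (I b); lra.
    by have := close _ _ _ ba tb; rewrite ler_norml; have := dp (I a); have := dp (I b); lra.
  have S0 : S t (X j t - 2 * d (I j)) by exists j.
  have ubS : ubound (S t) (X j t + 2 * d (I j)) by move=> _ [a ta ->]; exact: Sle.
  have h1 : sup (S t) <= X j t + 2 * d (I j) by apply: ge_sup => //; exists (X j t - 2 * d (I j)).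
  have h2 : X j t - 2 * d (I j) <= sup (S t).
    by apply: ub_le_sup => //; exists (X j t + 2 * d (I j)).
  by rewrite ler_norml; lra.
have xN t : ~ (exists j, t \in F (I j)) -> x t = x1 t by move=> no; rewrite /x asboolF.
clearbody x.
exists x; split.
- move=> t /F0F tF; have := @xX t 0%N; rewrite I0 => /(_ tF); rewrite /X st0 /= dz /x1.
  by case: t tF => // i b ->.
- have [N hN] : exists N, forall b, block 0 b \in F 0%N -> (b < N)%N.
    apply: finite_nat_bounded; apply: (@sub_finite_set _ _ [set` [seq if t is block _ b then b else 0%N | t <- F 0%N]]).
      by move=> b /= bF; apply/mapP; exists (block 0 b).
    exact: finite_seq.
  exists N => b Nb; have b0 : block 0 b \notin F 0%N.
    by apply: contraL Nb => /hN; rewrite -ltnNge.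
  have [[j bj]|no] := pselect (exists j, block 0 b \in F (I j)); last first.
    exists 0%N => //; rewrite xN // x1b // gerBl; exact: mulr_ge0 (ltW d00).
  have [i iM hi] := avoid j b b0; exists i => //.
  have h1 := xX (block i b) j (Fb _ _ _ _ iM bj).
  by have := sin_near (X j (block i b)) (x (block i b)) (tau i); lra.
- move=> m Dm e e0.
  have pU := (sel Dm).1.1.
  (* The six radii are: two for the later change of the word, one for the move of the limit letter
     in this step, two for its later movement, one for the accuracy of the step. *)
  have [i0 hi0] : exists i0, 6 * d i0 < e.
    have dpow i : d i * 2 ^+ i <= d0.
      elim: i => [|i IH]; first by rewrite dz expr0 mulr1.
      by rewrite exprS mulrA (le_trans _ IH) // ler_wpM2r // exprn_ge0.
    pose i0 := (Num.truncn (6 * d0 / e)).+1; exists i0.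
    have h1 : 6 * d0 < i0%:R * e.
      by rewrite -ltr_pdivrMr //; exact: (real_truncnS_gt (num_real _)).
    have h2 : i0%:R <= 2 ^+ i0 :> R by rewrite -natrX ler_nat ltnW // ltn_expl.
    have h3 : i0%:R * d i0 <= d0.
      by apply: le_trans (dpow i0); rewrite mulrC ler_wpM2l // ltW.
    have ip : (0 : R) < i0%:R by rewrite ltr0n.
    rewrite -(ltr_pM2l ip); apply: le_lt_trans h1.
    by rewrite mulrCA ler_pM2l.
  (* The stage advances only when a law acts; an action at [b] guarantees that it exceeds [i0] at
     all later indices. *)
  have [b Bb bi0] := infinite_unbounded i0 (free_infinite (sel Dm).1 (pB m Dm)).
  have Ib : I b.+1 = b.+1.
    by rewrite /I; case: (tr b) => [[no _]|[m' [_ _ -> _ _]]] //; case: (no m Dm).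
  apply: filterS (filterI (pB m Dm) (free_tail b.+1 (sel Dm).1)) => n [Bn /= bn] q qk.
  case: (tr n) => [[no _]|[m' [Dm' Bm' In1 ij [near _ targ _]]]]; first by case: (no m Dm).
  have mm : m' = m by apply: (B0disj _ _ n) => //; [case: Bm'|case: Bn].
  subst m'; move: ij near targ; set i := maxn _ _ => ij near targ.
  have i0i : (i0 <= i)%N.
    by rewrite /i leq_max -/(I n) (leq_trans _ (Imono _ _ bn)) // Ib leqW.
  have mi : (m < i)%N by rewrite leq_max ltnSn orbT.
  have mn : (m <= n)%N by exact: ltnW (leq_trans mi ij).
  have In1' : I n.+1 = n.+1 := In1.
  have e1 : `|ev x (v m n q) - ev (X n.+1) (v m n q)| <= 2 * d i.
    apply: le_trans (ev_close (d := 2 * d n.+1) _) _.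
      by move=> t tv; rewrite -{2}In1'; apply: xX; rewrite In1'; apply: Fv tv.
    apply: le_trans (dl1 n m n q mn (leqnn n) qk) _.
    by rewrite ler_pM2l // dmono.
  have ndF := Fnd i m q mi qk.
  have e2 := near _ ndF; rewrite -/(X n) -/(X n.+1) in e2.
  have e3 : `|x (nd m q) - X n.+1 (nd m q)| <= 2 * d i.
    apply: le_trans (xX (nd m q) n.+1 _) _; first by rewrite In1'; apply: Fmono ndF; exact: leqW.
    by rewrite In1' ler_pM2l // dmono // leqW.
  have e4 := targ q qk; rewrite -/(X n) -/(X n.+1) in e4.
  have di := dmono _ _ i0i.
  have := sin_near (ev x (v m n q) - x (nd m q)) (ev (X n.+1) (v m n q) - X n (nd m q)) 0.
  rewrite !subr0 => h5.
  have h6 : `|ev (X n.+1) (v m n q) - X n (nd m q) - (ev x (v m n q) - x (nd m q))| <=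
      `|ev x (v m n q) - ev (X n.+1) (v m n q)| + `|X n.+1 (nd m q) - X n (nd m q)|
      + `|x (nd m q) - X n.+1 (nd m q)|.
    rewrite (_ : _ - _ - _ = - (ev x (v m n q) - ev (X n.+1) (v m n q)) +
      (X n.+1 (nd m q) - X n (nd m q)) + (x (nd m q) - X n.+1 (nd m q))); last by ring.
    apply: le_trans (ler_normD _ _) _; rewrite lerD2r.
    by apply: le_trans (ler_normD _ _) _; rewrite normrN.
  by move: e1 e2 e3 e4 h5 h6; lra.
Qed.

End Construction.

(** * Extension to all generators *)

Section Extension.
Variable R : realType.

Lemma norm_sin_periodic (a : R) (m : int) : `|sin (a + m%:~R * pi)| = `|sin a|.
Proof.
have h l : `|sin (l%:~R * pi : R)| = 0.
  apply/eqP; rewrite eq_le normr_ge0 andbT.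
  by have := norm_sinMz l (pi : R); rewrite sinpi normr0 mulr0.
apply/eqP; rewrite eq_le; apply/andP; split.
  by rewrite (le_trans (norm_sinD _ _)) // h addr0.
rewrite -[X in sin X](addrK (m%:~R * pi) a) (le_trans (norm_sinD _ _)) //.
by rewrite norm_sinN h addr0.
Qed.

Lemma ultra_circle_limit (U : set_system nat) (u : nat -> R) : UltraFilter U ->
  exists z, forall e, 0 < e -> U [set n | `|sin (u n - z)| < e].
Proof.
move=> UU; pose u' n := u n + (- Num.floor (u n / pi))%:~R * pi.
have pi0 : 0 < pi :> R := pi_gt0 R.
have u'I n : `[0, pi]%classic (u' n).
  rewrite /= in_itv /= /u' rmorphN /= mulNr subr_ge0 lerBlDr.
  rewrite -ler_pdivlMr // floor_le_tmp /=.
  have := ltW (floorD1_gt (u n / pi)); rewrite ler_pdivrMr // rmorphD /= mulrDl mul1r addrC.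
  by [].
have [z [_ zcl]] := @segment_compact R 0 pi (u' @ U) _ (filterS (fun n _ => u'I n) filterT).
exists z => e e0; apply: contrapT => nU.
have uA : (u' @ U) (u' @` (~` [set n | `|sin (u n - z)| < e])).
  have hC := ultraC UU nU; change (U (u' @^-1` (u' @` (~` [set n | `|sin (u n - z)| < e])))).
  by apply: filterS hC => n hn; exists n.
have [r [/= hr1 hr2]] := zcl _ _ uA (nbhsx_ballx z e e0).
case: hr1 => n /= hn rn; apply: hn; rewrite -rn /ball /= in hr2.
rewrite distrC in hr2; apply: le_lt_trans hr2; apply: le_trans (norm_sin_le _).
by rewrite /u' addrAC norm_sin_periodic.
Qed.

Definition circle_lim (U : set_system nat) (u : nat -> R) : R :=
  xget 0 [set z | forall e, 0 < e -> U [set n | `|sin (u n - z)| < e]].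

Lemma circle_limP (U : set_system nat) (u : nat -> R) e : UltraFilter U -> 0 < e ->
  U [set n | `|sin (u n - circle_lim U u)| < e].
Proof.
move=> UU; move: e; rewrite /circle_lim; case: xgetP => // no.
by have [z zP] := ultra_circle_limit u UU; case: (no z).
Qed.

Definition nword (w : nat -> nat -> seq (int * nat)) (f : nat -> tree) n q : word :=
  [seq (a.1, f a.2) | a <- w n q].

Variables (M : nat) (p : tree -> set_system nat).
Hypothesis sel : forall t, selective (p t).
Hypothesis rk : forall t t', t <> t' -> ~ rk_le (p t) (p t').

(* The topology will be induced by the homomorphisms that satisfy this law: the
   letters [node k q w f], [q < k], are limits of the good [k]-tuple of sequences
   coded by [w] and [f], along the ultrafilter reserved for that tuple. *)
Definition limit_law (x : tree -> R) := forall k w f, (k <= M)%N -> good k (nword w f) ->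
  forall e, 0 < e -> p (node k 0 w f) [set n | forall q, (q < k)%N ->
    `|sin (ev x (nword w f n q) - x (node k q w f))| < e].

(** Outside [E] a limit letter gets the limit its law demands. The recursion is structural, since
    the words of the law use only the children [f l]. *)
Fixpoint extend (E : set tree) (x : tree -> R) (t : tree) : R :=
  if `[< E t >] then x t else
  if t is node k q w f then
    circle_lim (p (node k 0 w f)) (fun n => \sum_(a <- w n q) a.1%:~R * extend E x (f a.2))
  else 0.

Lemma extend_in E x t : E t -> extend E x t = x t.
Proof. by move=> Et; case: t Et => [A|i b|k q w f] Et /=; rewrite asboolT. Qed.

(** Siblings are included so that the limit letters of one law are all inside [E] or all outside. *)
Definition tree_closed (E : set tree) := forall k q w f, E (node k q w f) ->
  (forall l, E (f l)) /\ forall q', E (node k q' w f).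

Lemma extend_limit_law E x : tree_closed E ->
  (forall k w f, E (node k 0 w f) -> (k <= M)%N -> good k (nword w f) ->
    forall e, 0 < e -> p (node k 0 w f) [set n | forall q, (q < k)%N ->
      `|sin (ev x (nword w f n q) - x (node k q w f))| < e]) ->
  limit_law (extend E x).
Proof.
move=> Ecl H k w f kM gd e e0; have pU := (sel (node k 0 w f)).1.1.
have [En|En] := pselect (E (node k 0 w f)).
  have [Ef Eq] := Ecl _ _ _ _ En.
  apply: filterS (H k w f En kM gd e e0) => n hn q qk.
  rewrite extend_in //; have := hn q qk; congr (`|sin (_ - _)| < _).
  by rewrite /ev /nword !big_map; apply: eq_bigr => a _ /=; rewrite extend_in.
have nE q : ~ E (node k q w f) by move=> /Ecl[_ /(_ 0%N)].
suff : forall l, p (node k 0 w f) [set n | forall q, (q < l)%N ->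
    `|sin (ev (extend E x) (nword w f n q) - extend E x (node k q w f))| < e] by apply.
elim=> [|l IH]; first by apply: filterS filterT => n _ q.
have : p (node k 0 w f) [set n | `|sin (ev (extend E x) (nword w f n l) - extend E x (node k l w f))| < e].
  have := circle_limP (fun n => \sum_(a <- w n l) a.1%:~R * extend E x (f a.2)) pU e0.
  apply: filterS => n /=; rewrite asboolF //.
  by rewrite /ev /nword big_map.
move=> h; apply: filterS (filterI IH h) => n [h1 h2] q.
by rewrite ltnS leq_eqVlt => /orP[/eqP -> //|]; exact: h1.
Qed.

Definition tree_child (t : tree) (c : nat) : tree :=
  if t is node k q w f then
    match unpickle c : option (nat + nat) with
    | Some (inl l) => f l | Some (inr q') => node k q' w f | None => t end
  else t.

Lemma countable_closure (rt : nat -> tree) : exists en : nat -> tree,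
  tree_closed (range en) /\ forall l, range en (rt l).
Proof.
pose en m := if unpickle m is Some (l, s) then foldl tree_child (rt l) s else rt 0%N.
have enE l s : range en (foldl tree_child (rt l) s).
  by exists (pickle (l, s)) => //; rewrite /en pickleK.
have enc t c : range en t -> range en (tree_child t c).
  move=> [m _]; rewrite /en; case: (unpickle m) => [[l s]|] <-; last first.
    exact: (enE 0%N [:: c]).
  by have := enE l (rcons s c); rewrite foldl_rcons.
exists en; split; last by move=> l; exact: (enE l [::]).
move=> k q w f Et; split => [l|q'].
  by have := enc _ (pickle (inl l : nat + nat)) Et; rewrite /= pickleK.
by have := enc _ (pickle (inr q' : nat + nat)) Et; rewrite /= pickleK.
Qed.

Lemma exists_limit_law (F0 : seq tree) x0 (tau : nat -> R) (d0 : R) : 0 < d0 ->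
  exists x, [/\ limit_law x, forall t, t \in F0 -> `|x t - x0 t| <= 2 * d0
    & exists N, forall b, (N <= b)%N ->
      exists2 i, (i <= M)%N & 1 - 2 * d0 <= `|sin (x (block i b) - tau i)|].
Proof.
move=> d00.
pose rt l := match unpickle l : option (nat + nat * nat) with
  | Some (inl j) => nth (leaf set0) F0 j | Some (inr (i, b)) => block i b
  | None => leaf set0 end.
have [en [ecl ert]] := countable_closure rt.
have EF0 t : t \in F0 -> range en t.
  move=> tF; have := ert (pickle (inl (index t F0) : nat + nat * nat)).
  by rewrite /rt pickleK nth_index.
have Eb i b : range en (block i b).
  by have := ert (pickle (inr (i, b) : nat + nat * nat)); rewrite /rt pickleK.
(* The enumeration may repeat trees; keeping first occurrences makes distinct laws carry
   incomparable ultrafilters. *)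
pose D m := exists k w f, [/\ en m = node k 0 w f, (k <= M)%N, good k (nword w f)
  & forall m', (m' < m)%N -> en m' <> en m].
pose k_ m := if en m is node k _ _ _ then k else 0%N.
pose v m := if en m is node _ _ w f then nword w f else fun _ _ => [::].
pose nd m q := if en m is node k _ w f then node k q w f else leaf set0.
have [||||x [x1 x2 x3]] := @limit_construction R M D k_ v nd (p \o en) _ _ _ _ F0 x0 tau d0 d00.
- by move=> m [k [w [f [e kM _ _]]]]; rewrite /k_ e.
- by move=> m [k [w [f [e _ g _]]]]; rewrite /k_ /v e.
- by move=> m _; exact: sel.
- move=> m m' [k [w [f [e _ _ mi]]]] [k' [w' [f' [e' _ _ mi']]]] mm; apply: rk.
  by have [/mi'|/mi /nesym|//] := ltngtP m m'.
exists (extend (range en) x); split.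
- apply: extend_limit_law => // k w f En kM gd e e0.
  have ex : exists m, `[< en m = node k 0 w f >].
    by case: En => m _ <-; exists m; exact/asboolP.
  case: (ex_minnP ex) => m /asboolP em mmin.
  have Dm : D m.
    exists k, w, f; split => // m' lt e'.
    by have := mmin m'; rewrite leqNgt lt e' em => /(_ (introT (asboolP _) erefl)).
  by have := x3 m Dm e e0; rewrite /= /k_ /v /nd em.
- by move=> t tF; rewrite extend_in ?x1 //; exact: EF0.
- have [N hN] := x2; exists N => b Nb; have [i iM hi] := hN b Nb.
  by exists i => //; rewrite extend_in //; exact: Eb.
Qed.

End Extension.

(** * Cardinal arithmetic *)

Section Comparability.

Lemma inj_card_leT T U (A : set T) (B : set U) (f : T -> U) :
  (forall a, A a -> B (f a)) -> (forall a a', A a -> A a' -> f a = f a' -> a = a') -> A #<= B.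
Proof.
move=> fAB finj.
have e : f @` A #= A by apply: inj_card_eq => a a' /set_mem ? /set_mem ?; exact: finj.
rewrite -(card_le_eql e); apply: subset_card_le => _ [a Aa <-]; exact: fAB.
Qed.

Lemma card_le_inj T (U : pointedType) (A : set T) (B : set U) : A #<= B ->
  exists f : T -> U, (forall a, A a -> B (f a)) /\ (forall a a', A a -> A a' -> f a = f a' -> a = a').
Proof.
move=> /pcard_leP[f]; exists f; split => [a Aa|a a' Aa Aa']; first exact: 'funS_f.
by apply: 'inj_f; exact: mem_set.
Qed.

(** Zorn's lemma on graphs of partial injections from [A] to [B]: a maximal one is defined on all of
    [A] or reaches all of [B]. *)
Lemma card_le_total (K : pointedType) (A B : set K) : A #<= B \/ B #<= A.
Proof.
pose P := [set g : set (K * K) | [/\ forall a b, g (a, b) -> A a /\ B b,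
  forall a b b', g (a, b) -> g (a, b') -> b = b'
  & forall a a' b, g (a, b) -> g (a', b) -> a = a']].
have [F FP Ftot|g [[gAB gf gi] gmax]] := @Zorn_bigcup _ P.
  split.
  - by move=> a b [g Fg gab]; have [h _ _] := FP _ Fg; exact: h.
  - move=> a b b' [g Fg gab] [g' Fg' gab'].
    have [s|s] := Ftot _ _ Fg Fg'.
      by have [_ h _] := FP _ Fg'; exact: (h _ _ _ (s _ gab) gab').
    by have [_ h _] := FP _ Fg; exact: (h _ _ _ gab (s _ gab')).
  - move=> a a' b [g Fg gab] [g' Fg' gab'].
    have [s|s] := Ftot _ _ Fg Fg'.
      by have [_ _ h] := FP _ Fg'; exact: (h _ _ _ (s _ gab) gab').
    by have [_ _ h] := FP _ Fg; exact: (h _ _ _ gab (s _ gab')).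
have [domA|/existsNP[a]] := pselect (forall a, A a -> exists b, g (a, b)).
  left; have ex a : exists b, A a -> g (a, b).
    by have [/domA[b]|] := pselect (A a); [exists b|exists point].
  have [f fP] := choice ex; apply: (@inj_card_leT _ _ _ _ f) => [a Aa|a a' Aa Aa' e].
    by have [] := gAB _ _ (fP a Aa).
  by have h := fP a Aa; rewrite e in h; exact: gi (fP _ Aa').
move=> /not_implyP[Aa /forallNP na].
have [domB|/existsNP[b]] := pselect (forall b, B b -> exists a, g (a, b)).
  right; have ex b : exists a, B b -> g (a, b).
    by have [/domB[b']|] := pselect (B b); [exists b'|exists point].
  have [f fP] := choice ex; apply: (@inj_card_leT _ _ _ _ f) => [b Bb|b b' Bb Bb' e].
    by have [] := gAB _ _ (fP b Bb).
  by have h := fP b Bb; rewrite e in h; exact: gf (fP _ Bb').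
move=> /not_implyP[Bb /forallNP nb].
case: (gmax (g `|` [set (a, b)])).
  split; first by move=> x gx; left.
  by move=> h; case: (na b); apply: h; right.
split.
- by move=> x y [/gAB//|[-> ->]].
- move=> x y y' [h|[ex ey]] [h'|[ex' ey']]; subst => //.
  + exact: gf h h'.
  + by case: (na y).
  + by case: (na y').
- move=> x x' y [h|[ex ey]] [h'|[ex' ey']]; subst => //.
  + exact: gi h h'.
  + by case: (nb x).
  + by case: (nb x').
Qed.

End Comparability.

Section SeqCard.
Variable K : pointedType.
Implicit Types (w : seq K) (g : set (seq K * K)).

Let letter g : set K := [set c | exists a, g ([:: c], a)].

(** Graphs of injections of the nonempty words over an alphabet into that alphabet; the alphabet is
    read off from the one-letter words in the domain. *)
Let P := [set g : set (seq K * K) |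
  [/\ forall w a b, g (w, a) -> g (w, b) -> a = b,
    forall w w' a, g (w, a) -> g (w', a) -> w = w',
    forall w a, g (w, a) -> [/\ w != [::], forall c, c \in w -> letter g c & letter g a]
    & forall w, w != [::] -> (forall c, c \in w -> letter g c) -> exists a, g (w, a)]].

Let P_bigcup (F : set (set (seq K * K))) : F `<=` P -> total_on F subset ->
  P (\bigcup_(g in F) g).
Proof.
move=> FP Ftot.
have lmono g c : F g -> letter g c -> letter (\bigcup_(g in F) g) c.
  by move=> Fg [a ga]; exists a, g.
split.
- move=> w a b [g Fg gab] [g' Fg' gab'].
  have [s|s] := Ftot _ _ Fg Fg'.
    by have [h _ _ _] := FP _ Fg'; exact: (h _ _ _ (s _ gab) gab').
  by have [h _ _ _] := FP _ Fg; exact: (h _ _ _ gab (s _ gab')).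
- move=> w w' a [g Fg gab] [g' Fg' gab'].
  have [s|s] := Ftot _ _ Fg Fg'.
    by have [_ h _ _] := FP _ Fg'; exact: (h _ _ _ (s _ gab) gab').
  by have [_ h _ _] := FP _ Fg; exact: (h _ _ _ gab (s _ gab')).
- move=> w a [g Fg gwa]; have [_ _ /(_ w a gwa)[h1 h2 h3] _] := FP _ Fg.
  by split => // [c /h2|]; exact: (lmono g).
- move=> w w0 hw.
  have [g Fg gw] : exists2 g, F g & forall c, c \in w -> letter g c.
    elim: w w0 hw => // c w IH _ hw.
    have [a [g Fg gca]] := hw c (mem_head _ _).
    have [w0|w0] := eqVneq w [::].
      by exists g => // d; rewrite w0 inE => /eqP ->; exists a.
    have [|g' Fg' g'w] := IH w0; first by move=> d dw; apply: hw; rewrite inE dw orbT.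
    have [s|s] := Ftot _ _ Fg Fg'.
      exists g' => // d; rewrite inE => /orP[/eqP ->|/g'w//].
      by exists a; exact: s.
    exists g => // d; rewrite inE => /orP[/eqP ->|/g'w[b gb]]; first by exists a.
    by exists b; exact: s.
  have [_ _ _ /(_ w w0 gw)[a ga]] := FP _ Fg.
  by exists a, g.
Qed.

Let graph_fun g : P g -> exists i : seq K -> K,
  [/\ forall w, w != [::] -> (forall c, c \in w -> letter g c) -> g (w, i w),
   forall w, w != [::] -> (forall c, c \in w -> letter g c) -> letter g (i w)
  & forall w w', w != [::] -> (forall c, c \in w -> letter g c) ->
     w' != [::] -> (forall c, c \in w' -> letter g c) -> i w = i w' -> w = w'].
Proof.
move=> [g1 g2 g3 g4].
have ex w : exists a, w != [::] -> (forall c, c \in w -> letter g c) -> g (w, a).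
  have [[h1 h2]|no] := pselect (w != [::] /\ (forall c, c \in w -> letter g c)).
    by have [a ga] := g4 w h1 h2; exists a.
  by exists point => h1 h2; case: no.
have [i iP] := choice ex; exists i; split => //.
  by move=> w w0 wl; have [] := g3 _ _ (iP w w0 wl).
move=> w w' w0 wl w0' wl' e; have := iP _ w0 wl; rewrite e => h.
exact: g2 h (iP _ w0' wl').
Qed.

Lemma infinite_seq_inj : infinite_set [set: K] -> exists i : seq K -> K, injective i.
Proof.
move=> /infiniteP/card_le_inj[nu [_ nuinj]].
have nuI : injective nu by move=> a b; exact: nuinj.
have [g [Pg gmax]] := @Zorn_bigcup _ P P_bigcup.
have [i [gi li ii]] := graph_fun Pg.
have [g1 g2 g3 g4] := Pg.
(* The empty graph is not maximal: words over a copy of [nat] inside [K] are coded back into it by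
   [pickle]. *)
have [A0|/set0P[a0 Aa0]] := eqVneq (letter g) set0.
  pose g' : set (seq K * K) := [set x | exists s : seq nat,
     [/\ s != [::], x.1 = map nu s & x.2 = nu (pickle s)]].
  have lg' c : letter g' c <-> exists n, c = nu n.
    split => [[a [s [s0 /= e _]]]|[n ->]].
      by case: s s0 e => [|n [|m s]] // _ [->]; exists n.
    by exists (nu (pickle [:: n])), [:: n].
  have Pg' : P g'.
    split.
    - by move=> w a b [s [_ /= -> ->]] [s' [_ /= e ->]]; rewrite (inj_map nuI e).
    - by move=> w w' a [s [_ /= -> ->]] [s' [_ /= -> /nuI/(pcan_inj pickleK) ->]].
    - move=> w a [s [s0 /= -> ->]]; split.
      + by case: s s0.
      + by move=> c /mapP[n _ ->]; apply/lg'; exists n.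
      + by apply/lg'; eexists.
    - move=> w w0 wl.
      have [s e] : exists s, w = map nu s.
        elim: w {w0} wl => [|c w IH] wl; first by exists [::].
        have [|s ->] := IH; first by move=> d dw; apply: wl; rewrite inE dw orbT.
        have /lg'[n ->] := wl c (mem_head _ _).
        by exists (n :: s).
      exists (nu (pickle s)), s; split => //=.
      by apply: contraNneq w0 => s0; rewrite e s0.
  have gE : g = set0.
    by apply/eqP/negPn/negP => /set0P[[w a] /g3[_ _]]; rewrite A0.
  case: (gmax g') => //; rewrite gE; split => //.
  by move=> /(_ (map nu [:: 0%N], nu (pickle [:: 0%N]))); apply; exists [:: 0%N].
have nword1 c : letter g c -> forall d, d \in [:: c] -> letter g d.
  by move=> gc d; rewrite inE => /eqP ->.
have nword2 c : letter g c -> forall d, d \in [:: c; c] -> letter g d.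
  by move=> gc d; rewrite !inE orbb => /eqP ->.
have [le|le] := card_le_total (letter g) (~` letter g); last first.
  have [j [jA jinj]] := card_le_inj le.
  pose ka x := if `[< letter g x >] then i [:: x; x] else i [:: j x].
  have kaA x : letter g (ka x).
    rewrite /ka; case: asboolP => [Ax|nAx]; apply: li => //; first exact: nword2.
    by apply: nword1; exact: jA.
  have kaI : injective ka.
    move=> x y; rewrite /ka; case: asboolP => [Ax|nAx]; case: asboolP => [Ay|nAy] /ii.
    - by move=> /(_ isT (nword2 _ Ax) isT (nword2 _ Ay))[].
    - by move=> /(_ isT (nword2 _ Ax) isT (nword1 _ (jA _ nAy))).
    - by move=> /(_ isT (nword1 _ (jA _ nAx)) isT (nword2 _ Ay)).
    - by move=> /(_ isT (nword1 _ (jA _ nAx)) isT (nword1 _ (jA _ nAy)))[/jinj]; apply.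
  have wl w : forall c, c \in a0 :: map ka w -> letter g c.
    by move=> c; rewrite inE => /orP[/eqP ->//|/mapP[x _ ->]].
  (* The prefix [a0] makes the word nonempty, so that the empty word is coded too. *)
  exists (fun w => i (a0 :: map ka w)) => w w' e.
  have [] := ii (a0 :: map ka w) (a0 :: map ka w') isT (wl w) isT (wl w') e.
  exact: inj_map.
have [j [jA jinj]] := card_le_inj le.
pose A := letter g; pose A' := A `|` j @` A.
have inv_ y : exists x, (j @` A) y -> A x /\ j x = y.
  have [[x Ax e]|] := pselect ((j @` A) y); first by exists x.
  by exists point.
have [inv invP] := choice inv_.
pose ka x := if `[< A x >] then i [:: x; x] else i [:: inv x].
have A'inv x : A' x -> ~ A x -> A (inv x) /\ j (inv x) = x.
  by move=> [//|jx _]; exact: invP.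
have kaA x : A' x -> A (ka x).
  move=> A'x; rewrite /ka; case: asboolP => [Ax|nAx]; apply: li => //; first exact: nword2.
  by apply: nword1; have [] := A'inv x A'x nAx.
have kaI x y : A' x -> A' y -> ka x = ka y -> x = y.
  move=> A'x A'y; rewrite /ka; case: asboolP => [Ax|nAx]; case: asboolP => [Ay|nAy] /ii.
  - by move=> /(_ isT (nword2 _ Ax) isT (nword2 _ Ay))[].
  - by move=> /(_ isT (nword2 _ Ax) isT (nword1 _ (A'inv y A'y nAy).1)).
  - by move=> /(_ isT (nword1 _ (A'inv x A'x nAx).1) isT (nword2 _ Ay)).
  - move=> /(_ isT (nword1 _ (A'inv x A'x nAx).1) isT (nword1 _ (A'inv y A'y nAy).1))[e].
    by rewrite -(A'inv x A'x nAx).2 -(A'inv y A'y nAy).2 e.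
have kaw w : (forall c, c \in w -> A' c) -> forall c, c \in map ka w -> A c.
  by move=> h c /mapP[x /h /kaA h' ->].
have ka0 w : w != [::] -> map ka w != [::] by case: w.
have kawI w w' : (forall c, c \in w -> A' c) -> (forall c, c \in w' -> A' c) ->
    map ka w = map ka w' -> w = w'.
  elim: w w' => [|x w IH] [|y w'] // h h' [exy ew].
  have -> : x = y by apply: kaI exy; [apply: h|apply: h']; rewrite mem_head.
  by rewrite (IH w') // => c cw; [apply: h|apply: h']; rewrite inE cw orbT.
pose g' : set (seq K * K) := g `|` [set x | [/\ x.1 != [::], forall c, c \in x.1 -> A' c,
  ~ (forall c, c \in x.1 -> A c) & x.2 = j (i (map ka x.1))]].
have lg' c : letter g' c <-> A' c.
  split.
    move=> [a [/g3[_ /(_ c (mem_head _ _)) h _]|[_ /(_ c (mem_head _ _)) //]]].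
    by left.
  move=> A'c; have [[a ga]|nAc] := pselect (A c); first by exists a; left.
  exists (j (i (map ka [:: c]))); right; split => //.
    by move=> d; rewrite inE => /eqP ->.
  by move=> /(_ c (mem_head _ _)).
have newB w : w != [::] -> (forall c, c \in w -> A' c) -> A (i (map ka w)).
  by move=> w0 wA'; apply: li; [exact: ka0|exact: kaw].
have Pg' : P g'.
  split.
  - move=> w a b [h|[_ _ h /= ->]] [h'|[_ _ h' /= ->]] //; first exact: g1 h h'.
      by case: h'; have [_ ? _] := g3 _ _ h.
    by case: h; have [_ ? _] := g3 _ _ h'.
  - move=> w w' a [h|[/= w0 wA' _ ->]] [h'|[/= w0' wA'' _ e]].
    + exact: g2 h h'.
    + have [_ _ Aa] := g3 _ _ h; case: (jA _ (newB _ w0' wA'')).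
      by rewrite -e.
    + have [_ _ Aa] := g3 _ _ h'.
      by case: (jA _ (newB _ w0 wA')).
    + apply: kawI => //; apply: ii => //; try exact: ka0; try exact: kaw.
      by apply: jinj e; exact: newB.
  - move=> w a [h|[/= w0 wA' _ ->]].
      have [h1 h2 h3] := g3 _ _ h; split => // [c /h2 Ac|]; apply/lg'; by left.
    split => // [c /wA' h|]; apply/lg' => //.
    by right; exists (i (map ka w)) => //; exact: newB.
  - move=> w w0 wl.
    have [h|h] := pselect (forall c, c \in w -> A c).
      by have [a ga] := g4 w w0 h; exists a; left.
    exists (j (i (map ka w))); right; split => // c cw; apply/lg'; exact: wl.
case: (gmax g') => //; split; first by move=> x gx; left.
move=> sub.
have Bj : A' (j a0) by right; exists a0.
have nB : ~ A (j a0) by exact: jA.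
have /lg'[a ga] := Bj.
by apply: nB; exists a; exact: sub.
Qed.

End SeqCard.

(** * Cardinality of the tree type and of a basis *)

HB.instance Definition _ := isPointed.Build tree (leaf set0).

Definition tree_label (t : tree) : set (nat * (nat * nat) * seq (int * nat)) :=
  match t with
  | leaf A => [set x | exists2 n, A n & x = (0%N, (n, 0%N), [::])]
  | block i b => [set (1%N, (i, b), [::])]
  | node k i w f => [set x | x = (3, (k, i), [::]) \/ exists n q, x = (2, (n, q), w n q)]
  end.

(** The labels found at the end of the path [s] of child indices. The first component of a label
    tells the constructors apart, so a tree amounts to a set of paths with labels, a subset of a
    countable type. *)
Fixpoint tree_code (t : tree) (s : seq nat) : set (nat * (nat * nat) * seq (int * nat)) :=
  if s is n :: s' then (if t is node _ _ _ f then tree_code (f n) s' else set0)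
  else tree_label t.

Lemma tree_code_inj : injective tree_code.
Proof.
elim=> [A|i b|k i w f IH] [A'|i' b'|k' i' w' f'] e;
  have := congr1 (fun h => h [::]) e; rewrite /= => /seteqP[l1 l2].
- congr leaf; apply/seteqP; split => n An.
    by have [|m A'm [->]] := l1 (0%N, (n, 0%N), [::]); first by exists n.
  by have [|m A'm [->]] := l2 (0%N, (n, 0%N), [::]); first by exists n.
- by have [//|? _] := l2 (1%N, (i', b'), [::]).
- by have [|? _] := l2 (3, (k', i'), [::]); first by left.
- by have [//|? _] := l1 (1%N, (i, b), [::]).
- by have := l1 _ erefl; case=> -> ->.
- by have [] := l1 (1%N, (i, b), [::]) erefl => [//|[? [? ]]].
- by have [|? _] := l1 (3, (k, i), [::]); first by left.
- by have [] := l2 (1%N, (i', b'), [::]) erefl => [//|[? [? ]]].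
- have [||[n [q]]] := l1 (3, (k, i), [::]) => //; first by left.
  move=> [<- <-].
  have -> : w = w'.
    apply/funext => n; apply/funext => q.
    by have [|//|[n' [q' [-> -> ]]]] := l1 (2, (n, q), w n q); first by right; exists n, q.
  congr node; apply/funext => n; apply: IH; apply/funext => s.
  exact: (congr1 (fun h => h (n :: s)) e).
Qed.

Lemma set_countType_card (X : countType) T (c : T -> set X) : injective c ->
  [set: T] #<= [set: set nat].
Proof.
move=> ci; apply: (@inj_card_leT _ _ _ _ (fun t => pickle @` c t)) => // t t' _ _ e.
apply: ci; apply/seteqP; split => x cx.
  have : (pickle @` c t) (pickle x) by exists x.
  by rewrite e => -[y cy /(pcan_inj pickleK) <-].
have : (pickle @` c t') (pickle x) by exists x.
by rewrite -e => -[y cy /(pcan_inj pickleK) <-].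
Qed.

Lemma card_tree : [set: tree] #= [set: set nat].
Proof.
apply: Cantor_Bernstein; last first.
  by apply: (@inj_card_leT _ _ _ _ leaf) => // A A' _ _ [].
apply: (@set_countType_card _ _ (fun t => [set x : seq nat * (nat * (nat * nat) * seq (int * nat)) | tree_code t x.1 x.2])).
move=> t t' e; apply: tree_code_inj; apply/funext => s; apply/seteqP; split => x cx.
  have : [set x | tree_code t x.1 x.2] (s, x) by [].
  by rewrite e.
have : [set x | tree_code t' x.1 x.2] (s, x) by [].
by rewrite -e.
Qed.

Lemma cantor_nat : ~ ([set: set nat] #<= [set: nat]).
Proof.
move=> /card_le_inj[f [_ finj]].
pose Dg := [set n | forall A, f A = n -> ~ A n].
have [h|h] := pselect (Dg (f Dg)); first exact: (h Dg).
by apply: h => A fA; rewrite (finj _ _ I I fA) => h; exact: (h Dg).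
Qed.

Section FreeBasis.
Variables (G : zmodType) (K : choiceType) (f : {additive {freeg K} -> G}).
Variables (g : G -> {freeg K}) (fK : cancel f g) (gK : cancel g f).

(** An element of [G] is a finite sequence over [int * K]. A finite [K] would make [G] countable;
    for an infinite [K] these sequences inject into [K]. *)
Lemma basis_card : [set: G] #= [set: set nat] -> [set: K] #= [set: set nat].
Proof.
move=> cG; apply: Cantor_Bernstein.
  rewrite -(card_le_eqr cG).
  apply: (@inj_card_leT _ _ _ _ (fun k => f << k >>)) => // k k' _ _ /(can_inj fK).
  move=> /(congr1 (coeff k)); rewrite !coeffU eqxx.
  by case: eqP => // _.
have enum_inj : injective (fun x : G => fgenum (g x)).
  by move=> x y e; rewrite -(gK x) -(gK y) -(Freeg_enum (g x)) e Freeg_enum.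
rewrite -(card_le_eql cG).
have cG0 : ~ ([set: G] #<= [set: nat]).
  by rewrite (card_le_eql cG); exact: cantor_nat.
have [kfin|kinf] := pselect (finite_set [set: K]).
  case: cG0; have /card_le_inj[nu [_ nuinj]] := finite_set_countable kfin.
  apply: (@inj_card_leT _ _ _ _ (fun x : G => pickle [seq (a.1, nu a.2) | a <- fgenum (g x)])) => //.
  move=> x y _ _ /(pcan_inj pickleK) e; apply: enum_inj; move: e; apply: inj_map.
  by move=> [a k] [b l] [-> /(nuinj _ _ I I) ->].
have [k0 _] := infinite_setN0 kinf.
pose PK : pointedType := HB.pack_for pointedType K (isPointed.Build K k0).
have [i ii] := @infinite_seq_inj PK kinf.
(* The coefficient is stored as the length of a constant word, made positive so that the basis
   element can be recovered. *)
pose pr (a : int * K) : K := i (nseq (pickle a.1).+1 a.2).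
have prI : injective pr.
  move=> [a k] [b l] /ii /=; case=> -> e; congr pair.
  by apply: (pcan_inj pickleK); have := congr1 size e; rewrite !size_nseq.
apply: (@inj_card_leT _ _ _ _ (fun x : G => i (map pr (fgenum (g x))))) => //.
move=> x y _ _ /ii e; apply: enum_inj; move: e; exact: inj_map.
Qed.

End FreeBasis.

(** * The group topology *)

Section TreeBasis.
Variables (R : realType) (G : zmodType) (K : choiceType) (f : {additive {freeg K} -> G}).
Variables (g : G -> {freeg K}) (fK : cancel f g) (gK : cancel g f).
Variables (bt : K -> tree) (tb : tree -> K) (btK : cancel bt tb) (tbK : cancel tb bt).
Implicit Types (a b : G) (x : tree -> R) (t : tree).

Definition wd a : word := [seq (c.1, bt c.2) | c <- fgenum (g a)].
Definition gen t : G := f << tb t >>.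

Let gB a b : g (a - b) = g a - g b.
Proof. by apply: (can_inj fK); rewrite gK raddfB !gK. Qed.

Lemma coef_wd t a : coef t (wd a) = coeff (tb t) (g a).
Proof.
rewrite -[in RHS](Freeg_enum (g a)) coeff_Freeg /precoeff /coef /wd big_map [RHS]big_mkcond /=.
apply: eq_bigr => c _; rewrite -(inj_eq (can_inj tbK)) btK.
by case: eqP => _; rewrite ?mulr1 ?mulr0.
Qed.

Lemma coef_wdB t a b : coef t (wd (a - b)) = coef t (wd a) - coef t (wd b).
Proof. by rewrite !coef_wd gB coeffB. Qed.

Lemma wd_eq a b : (forall t, coef t (wd a) = coef t (wd b)) -> a = b.
Proof.
move=> H; rewrite -(gK a) -(gK b); congr (f _); apply/eqP/freeg_eqP => k.
by have := H (bt k); rewrite !coef_wd btK.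
Qed.

Lemma ev_wdB x a b : ev x (wd (a - b)) = ev x (wd a) - ev x (wd b).
Proof.
pose J := undup (letters (wd (a - b)) ++ letters (wd a) ++ letters (wd b)).
have uJ : uniq J by exact: undup_uniq.
rewrite !(ev_coef x uJ); first last.
- by move=> t tw; rewrite mem_undup !mem_cat tw.
- by move=> t tw; rewrite mem_undup !mem_cat tw !orbT.
- by move=> t tw; rewrite mem_undup !mem_cat tw !orbT.
rewrite -sumrB; apply: eq_bigr => t _.
by rewrite coef_wdB rmorphB /= mulrBl.
Qed.

Lemma coef_gen t s : coef t (wd (gen s)) = (s == t)%:R.
Proof.
rewrite coef_wd /gen fK coeffU mul1r.
by rewrite -(inj_eq (can_inj tbK)).
Qed.

Lemma ev_gen x t : ev x (wd (gen t)) = x t.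
Proof.
pose J := undup (t :: letters (wd (gen t))).
have uJ : uniq J by exact: undup_uniq.
rewrite (ev_coef x uJ); last by move=> s sw; rewrite mem_undup inE sw orbT.
have tJ : t \in J by rewrite mem_undup mem_head.
rewrite (bigD1_seq t) //= coef_gen eqxx mul1r big1 ?addr0 // => s st.
by rewrite coef_gen eq_sym (negbTE st) mul0r.
Qed.

End TreeBasis.

(** * Accumulation points of tuples of sequences *)

Section Accumulation.
Variables (R : realType) (G : zmodType) (wd : G -> word) (gen : tree -> G).
Hypothesis coef_wdB : forall t a b, coef t (wd (a - b)) = coef t (wd a) - coef t (wd b).
Hypothesis wd_eq : forall a b, (forall t, coef t (wd a) = coef t (wd b)) -> a = b.
Hypothesis ev_wdB : forall (x : tree -> R) a b, ev x (wd (a - b)) = ev x (wd a) - ev x (wd b).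
Hypothesis ev_gen : forall (x : tree -> R) t, ev x (wd (gen t)) = x t.
Variables (M : nat) (p : tree -> set_system nat).
Hypothesis sel : forall t, selective (p t).
Implicit Types (a b : G) (x : tree -> R).

Definition phi x a : R := ev x (wd a).
HB.instance Definition _ x := GRing.isAdditive.Build G R (phi x) (ev_wdB x).
Let cf t a : int := coef t (wd a).
HB.instance Definition _ t := GRing.isAdditive.Build G int (cf t) (coef_wdB t).

Lemma torsion_free a b (m : int) : m != 0 -> a *~ m = b *~ m -> a = b.
Proof.
move=> m0 e; apply: wd_eq => t; rewrite -/(cf t a) -/(cf t b).
have := congr1 (cf t) e; by rewrite !raddfMz !mulrzz => /(mulIf m0).
Qed.

Definition near_pt k n (X : nat -> tree -> R) (e : R) (a b : nat -> G) :=
  forall q i, (q < k)%N -> (i < n)%N -> `|sin (phi (X i) (a q - b q))| < e.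

Definition good_seq k (u : nat -> nat -> G) := forall r : 'I_k -> int,
  (exists i, r i != 0) -> forall b, finite_set [set j | \sum_(q < k) u j q *~ r q = b].

(** The limit letters of the coded tuple serve as the accumulation point: one ultrafilter handles
    all homomorphisms at once, and finitely many of its sets still meet in an infinite set. *)
Lemma good_seq_accumulation k (u : nat -> nat -> G) : (k <= M)%N -> good_seq k u ->
  exists y : nat -> G, forall n (X : nat -> tree -> R) e,
    (forall i, (i < n)%N -> limit_law M p (X i)) -> 0 < e ->
    infinite_set [set j | near_pt k n X e (u j) y].
Proof.
move=> kM gd.
pose wl n q := wd (u n q).
(* Letters are addressed by their position [(n, q, l)] in the words, so that [f] lists all of
   them. *)
pose w n q : seq (int * nat) :=
  [seq ((nth (0, leaf set0) (wl n q) l).1, pickle (n, q, l)) | l <- iota 0 (size (wl n q))].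
pose f m : tree := if unpickle m is Some (n, q, l) then (nth (0, leaf set0) (wl n q) l).2 else leaf set0.
have wE n q : nword w f n q = wd (u n q).
  rewrite /nword /w -map_comp -[RHS](mkseq_nth (0, leaf set0)); apply: eq_map => l /=.
  by rewrite /f pickleK -surjective_pairing.
have gdw : good k (nword w f).
  move=> r r0 c; set A := [set n | _].
  have rE n t : \sum_(q < k) r q * coef t (nword w f n q) = cf t (\sum_(q < k) u n q *~ r q).
    rewrite raddf_sum; apply: eq_bigr => q _.
    by rewrite wE raddfMz /= -mulrzr mulrC intz.
  have [->|/set0P[n0 An0]] := eqVneq A set0; first exact: finite_set0.
  apply: sub_finite_set (gd r r0 (\sum_(q < k) u n0 q *~ r q)) => n An /=.
  by apply: wd_eq => t; rewrite -/(cf t _) -/(cf t (\sum_(q < k) u n0 q *~ r q)) -!rE An An0.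
exists (fun q => gen (node k q w f)) => n X e XL e0.
have fp := (sel (node k 0 w f)).1; have pU := fp.1.
apply: (free_infinite fp).
suff : forall l, (l <= n)%N -> p (node k 0 w f)
    [set j | near_pt k l X e (u j) (fun q => gen (node k q w f))] by apply.
elim=> [|l IH] ln; first by apply: filterS filterT => j _ q i.
have XLl := XL l ln k w f kM gdw e e0.
apply: filterS (filterI (IH (ltnW ln)) XLl) => j [h1 h2] q i qk.
rewrite ltnS leq_eqVlt => /orP[/eqP ->|]; last exact: h1.
by have := h2 q qk; rewrite raddfB /= {2}/phi ev_gen /phi wE.
Qed.

(** If a combination [r] is constant along a subsequence, write [r] as an integer [m] times a row of
    a unimodular matrix. As [G] is torsion-free, the coordinate for that row is constant as well,
    and the change of basis leaves a tuple shorter by one. *)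
Lemma seq_accumulation k (u : nat -> nat -> G) : (k <= M)%N ->
  exists y : nat -> G, forall n (X : nat -> tree -> R) e,
    (forall i, (i < n)%N -> limit_law M p (X i)) -> 0 < e ->
    infinite_set [set j | near_pt k n X e (u j) y].
Proof.
elim: k u => [|k IH] u kM.
  apply: good_seq_accumulation => // r [[]]//.
have [|] := pselect (good_seq k.+1 u); first exact: good_seq_accumulation.
move=> /existsNP[r /not_implyP[[i1 ri0] /existsNP[b binf]]].
have [L Lu [Q Qu [d _ rE]]] := int_Smith_normal_form (\row_q r q).
pose m := L 0 0 * nth 0 d 0%N.
have rQ q : r q = m * Q 0 q.
  have := congr1 (fun B : 'rV[int]_k.+1 => B 0 q) rE; rewrite !mxE => ->.
  rewrite (bigD1 ord0) //= big1 ?addr0 => [|i i0].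
    rewrite mxE big_ord1 mxE eqxx mulr1n /m. 
    by [].
  rewrite mxE big_ord1 mxE eq_sym.
  by case: i i0 => -[|i] //= ? _; rewrite mulr0n mulr0 mul0r.
have m0 : m != 0 by apply: contraNneq ri0 => m0; rewrite rQ m0 mul0r.
pose c i j : G := \sum_(l < k.+1) u j l *~ Q i l.
have cb j : \sum_(q < k.+1) u j q *~ r q = b -> c 0 j *~ m = b.
  move=> <-; rewrite /c mulrz_suml; apply: eq_bigr => q _.
  by rewrite rQ -mulrzA mulrC.
pose S := invmx Q.
have uE j (q : 'I_k.+1) : u j q = \sum_i c i j *~ S q i.
  under eq_bigr do rewrite /c mulrz_suml.
  rewrite exchange_big /= (bigD1 q) //= [X in _ = _ + X]big1 ?addr0 => [|l lq].
    rewrite -[LHS]mulr1z.  under eq_bigr do rewrite -mulrzA mulrC.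
    rewrite -mulrz_sumr; congr (_ *~ _).
    by have := congr1 (fun B : 'M[int]_k.+1 => B q q) (mulVmx Qu); rewrite [in LHS]mxE [in RHS]mxE eqxx => ->.
  under eq_bigr do rewrite -mulrzA mulrC.
  rewrite -mulrz_sumr (_ : \sum_i _ = 0) ?mulr0z //.
  have := congr1 (fun B : 'M[int]_k.+1 => B q l) (mulVmx Qu).
  by rewrite [in LHS]mxE [in RHS]mxE eq_sym (negbTE lq) => ->.
have [s [sA sI]] := card_le_inj ((infiniteP _).1 binf).
have c0 j : c 0 (s j) = c 0 (s 0%N).
  by apply: torsion_free m0 _; rewrite !cb //; exact: sA.
have [y' hy'] := IH (fun j q => c (inord q.+1) (s j)) (ltnW kM).
(* The limit in the new coordinates: coordinate 0 is constant along [s], and the others are shifted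
   by one from the induction hypothesis. [S] transforms back, at the cost of the factor [C] in the
   error. *)
pose z (i : 'I_k.+1) := if i == 0 then c 0 (s 0%N) else y' i.-1.
exists (fun q => \sum_i z i *~ S (inord q) i) => n X e XL e0.
pose C : R := \sum_q \sum_i `|S q i|%:~R.
have C0 : 0 <= C by apply: sumr_ge0 => q _; apply: sumr_ge0 => i _; rewrite ler0z.
have C1 : 0 < 1 + C by rewrite ltr_pwDl.
pose e' := e / (1 + C).
have e'0 : 0 < e' by rewrite divr_gt0.
have inf := hy' n X e' XL e'0.
have sinf : infinite_set (s @` [set j | near_pt k n X e' (fun q => c (inord q.+1) (s j)) y']).
  move=> fin; apply: inf.
  have e1 := @inj_card_eq _ _ [set j | near_pt k n X e' (fun q => c (inord q.+1) (s j)) y'] s.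
  by rewrite -(eq_finite_set (e1 _)) // => a1 a2 _ _; exact: sI.
apply: sub_infinite_set sinf => _ [j /= hj <-] q i qk i_n.
have nr (l : 'I_k.+1) : `|sin (phi (X i) (c l (s j) - z l))| <= e'.
  rewrite /z; have [->|l0] := eqVneq l 0; first by rewrite c0 subrr raddf0 sin0 normr0 ltW.
  have lk : (l.-1 < k)%N by case: l l0 => -[|l].
  have := hj l.-1 i lk i_n; rewrite prednK ?lt0n //.
  by rewrite inord_val => /ltW.
rewrite -{1}(inordK qk) uE -sumrB raddf_sum /=.
apply: le_lt_trans (norm_sin_sum _ _) _.
apply: (@le_lt_trans _ _ (\sum_l `|S (inord q) l|%:~R * e')).
  apply: ler_sum => l _; rewrite -mulrzBl raddfMz -mulrzl.
  by apply: le_trans (norm_sinMz _ _) _; rewrite ler_wpM2l ?ler0z ?nr.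
rewrite -mulr_suml /e' mulrCA -[ltRHS]mulr1 ltr_pM2l // ltr_pdivrMr // mul1r.
apply: (@le_lt_trans _ _ C); last by rewrite ltrDr.
rewrite /C [leRHS](bigD1 (inord q)) //= lerDl.
by apply: sumr_ge0 => q' _; apply: sumr_ge0 => l _; rewrite ler0z.
Qed.
End Accumulation.

(** * Group topologies from neighbourhood systems, and finite powers *)

Record group_nbhs (G : zmodType) := GroupNbhs {
  gnbhs :> G -> set_system G;
  gnbhs_filter : forall a, ProperFilter (gnbhs a);
  gnbhs_singleton : forall a A, gnbhs a A -> A a;
  gnbhs_nbhs : forall a A, gnbhs a A -> gnbhs a (gnbhs^~ A);
  gnbhs_sub : forall a b A, gnbhs (a - b) A ->
    exists B C, [/\ gnbhs a B, gnbhs b C & forall x y, B x -> C y -> A (x - y)] }.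

(** An alias of [G] that remembers [N], to which the topological instances can be attached. *)
Definition nbhs_group (G : zmodType) (N : group_nbhs G) : Type := G.

Section NbhsGroup.
Variables (G : zmodType) (N : group_nbhs G).
HB.instance Definition _ := GRing.Zmodule.copy (nbhs_group N) G.
HB.instance Definition _ := hasNbhs.Build (nbhs_group N) (gnbhs N).
HB.instance Definition _ := Nbhs_isNbhsTopological.Build (nbhs_group N)
  (@gnbhs_filter G N) (@gnbhs_singleton G N) (@gnbhs_nbhs G N).

Lemma nbhs_group_sub_continuous :
  continuous (fun x : nbhs_group N * nbhs_group N => x.1 - x.2).
Proof.
move=> [a b] A /= nA; have [B [C [NB NC BC]]] := gnbhs_sub nA.
by exists (B, C) => //= -[x y] [/= Bx Cy]; exact: BC.
Qed.

HB.instance Definition _ := PreTopologicalNmodule_isTopologicalZmodule.Build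
  (nbhs_group N) nbhs_group_sub_continuous.
End NbhsGroup.

(** Once [G] is taken apart into its carrier and its mixins, the copied structure is convertible to
    the original. *)
Lemma nbhs_group_zmod (G : zmodType) (N : group_nbhs G) :
  (nbhs_group N : topologicalZmodType) = G :> zmodType.
Proof. by case: G N => T [? ? ? ? ? ? ?] N. Qed.

Section Pointwise.
Variables (T : topologicalType) (k : nat).

Lemma ptws_nbhs_proj (i : 'I_k) (y : {ptws 'I_k -> T}) (A : set T) :
  nbhs (y i) A -> nbhs y [set z : {ptws 'I_k -> T} | A (z i)].
Proof. exact: (@proj_continuous _ (fun _ : 'I_k => T) i y). Qed.

Lemma ptws_accumulation (u : nat -> {ptws 'I_k -> T}) (y : {ptws 'I_k -> T}) :
  (forall A : 'I_k -> set T, (forall i, nbhs (y i) (A i)) ->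
    infinite_set [set n | forall i, A i (u n i)]) ->
  accumulation_point u y.
Proof.
move=> H U Uy.
(* The filter generated by boxes. It converges to [y] in each coordinate, hence in the product, so
   every neighbourhood of [y] contains a box. *)
pose F : set_system {ptws 'I_k -> T} := [set B | exists A : 'I_k -> set T,
   (forall i, nbhs (y i) (A i)) /\ [set z | forall i, A i (z i)] `<=` B].
have FF : Filter F.
  split.
  - by exists (fun=> setT); split => // i; exact: filterT.
  - move=> P Q [A [hA AP]] [B [hB BQ]]; exists (fun i => A i `&` B i); split.
      by move=> i; exact: filterI.
    by move=> z hz; split; [apply: AP => i; exact: (hz i).1|apply: BQ => i; exact: (hz i).2].
  - by move=> P Q PQ [A [hA AP]]; exists A; split => // z /AP /PQ.
have : F --> y.
  apply/cvg_sup => i B; rewrite nbhsE => -[C [[D oD <-] Dy] CB].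
  exists (fun j => if j == i then D else setT); split.
    move=> j; case: eqP => [->|_]; last exact: filterT.
    exact: open_nbhs_nbhs.
  by move=> z /(_ i); rewrite eqxx => Dz; exact: CB.
move=> /(_ U Uy)[A [hA AU]]; apply: sub_infinite_set (H A hA) => n hn.
exact: AU.
Qed.

End Pointwise.

(** * The topology induced by the homomorphisms *)

Section Topology.
Variables (R : realType) (G : zmodType) (wd : G -> word) (gen : tree -> G).
Hypothesis coef_wdB : forall t a b, coef t (wd (a - b)) = coef t (wd a) - coef t (wd b).
Hypothesis wd_eq : forall a b, (forall t, coef t (wd a) = coef t (wd b)) -> a = b.
Hypothesis ev_wdB : forall (x : tree -> R) a b, ev x (wd (a - b)) = ev x (wd a) - ev x (wd b).
Hypothesis ev_gen : forall (x : tree -> R) t, ev x (wd (gen t)) = x t.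
Variables (M : nat) (p : tree -> set_system nat).
Hypothesis sel : forall t, selective (p t).
Hypothesis rk : forall t t', t <> t' -> ~ rk_le (p t) (p t').
Implicit Types (a b : G) (x : tree -> R).

Local Notation phi := (@phi R G wd).
Local Notation law := (@limit_law R M p).

Let phiB x a b : phi x (a - b) = phi x a - phi x b := ev_wdB x a b.

Definition ball_phi n (X : nat -> tree -> R) (e : R) a : set G :=
  [set b | forall i, (i < n)%N -> `|sin (phi (X i) (b - a))| < e].

Definition phi_nbhs a : set_system G := [set A | exists n X e,
  [/\ forall i, (i < n)%N -> law (X i), 0 < e & ball_phi n X e a `<=` A]].

Let phi_nbhs_ball n X e a : (forall i, (i < n)%N -> law (X i)) -> 0 < e ->
  phi_nbhs a (ball_phi n X e a).
Proof. by move=> XL e0; exists n, X, e; split. Qed.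

Lemma ball_phi_merge n X e m Y d :
  (forall i, (i < n)%N -> law (X i)) -> 0 < e -> (forall i, (i < m)%N -> law (Y i)) -> 0 < d ->
  exists l Z c, [/\ forall i, (i < l)%N -> law (Z i), 0 < c
    & forall a, ball_phi l Z c a `<=` ball_phi n X e a `&` ball_phi m Y d a].
Proof.
move=> XL e0 YL d0.
exists (n + m)%N, (fun i => if (i < n)%N then X i else Y (i - n)%N), (Num.min e d); split.
- move=> i inm; case: ltnP => ni; first exact: XL.
  by apply: YL; rewrite ltn_subLR.
- by rewrite lt_min e0.
- move=> a b hb; split => i hi.
    have := hb i (ltn_addr _ hi); rewrite hi lt_min => /andP[]//.
  have := hb (n + i)%N; rewrite ltn_add2l hi ltnNge leq_addr /= addKn => /(_ isT).
  by rewrite lt_min => /andP[].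
Qed.

Let phi_nbhs_filter a : ProperFilter (phi_nbhs a).
Proof.
split.
  move=> [n [X [e [_ e0 /(_ a)]]]]; apply => i _.
  by rewrite phiB subrr sin0 normr0.
split.
- by exists 0%N, (fun _ _ => 0), 1; split.
- move=> P Q [n [X [e [XL e0 XP]]]] [m [Y [d [YL d0 YQ]]]].
  have [l [Z [c [ZL c0 ZXY]]]] := ball_phi_merge XL e0 YL d0.
  by exists l, Z, c; split => // b /ZXY[/XP ? /YQ ?].
- by move=> P Q PQ [n [X [e [XL e0 XP]]]]; exists n, X, e; split => // b /XP /PQ.
Qed.

Let phi_nbhs_singleton a A : phi_nbhs a A -> A a.
Proof.
by move=> [n [X [e [_ e0]]]]; apply => i _; rewrite phiB subrr sin0 normr0.
Qed.

Let phi_nbhs_half n X (e : R) a b c :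
  ball_phi n X (e / 2) a b -> ball_phi n X (e / 2) b c -> ball_phi n X e a c.
Proof.
move=> ab bc i i_n.
have -> : phi (X i) (c - a) = phi (X i) (c - b) + phi (X i) (b - a).
  by rewrite !phiB addrA subrK.
have h1 := ab i i_n; have h2 := bc i i_n.
apply: le_lt_trans (norm_sinD _ _) _.
by rewrite [e]splitr addrC ltrD.
Qed.

Let phi_nbhs_nbhs a A : phi_nbhs a A -> phi_nbhs a (phi_nbhs^~ A).
Proof.
move=> [n [X [e [XL e0 XA]]]]; exists n, X, (e / 2); split => //; first exact: divr_gt0.
move=> b ab; exists n, X, (e / 2); split => //; first exact: divr_gt0.
by move=> c bc; apply: XA; exact: phi_nbhs_half ab bc.
Qed.

Let phi_nbhs_sub a b A : phi_nbhs (a - b) A ->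
  exists B C, [/\ phi_nbhs a B, phi_nbhs b C & forall c d, B c -> C d -> A (c - d)].
Proof.
move=> [n [X [e [XL e0 XA]]]].
have e2 : 0 < e / 2 by rewrite divr_gt0.
exists (ball_phi n X (e / 2) a), (ball_phi n X (e / 2) b); split; [exact: phi_nbhs_ball..|].
move=> c d ac bd; apply: XA => i i_n.
have -> : phi (X i) (c - d - (a - b)) = phi (X i) (c - a) + - phi (X i) (d - b).
  by rewrite !phiB !opprB addrACA [RHS]addrACA; congr (_ + _); rewrite addrC.
apply: le_lt_trans (norm_sinD _ _) _; rewrite norm_sinN.
by have := ac i i_n; have := bd i i_n; lra.
Qed.

Definition phi_group_nbhs : group_nbhs G := GroupNbhs phi_nbhs_filter
  phi_nbhs_singleton phi_nbhs_nbhs phi_nbhs_sub.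

Local Notation TG := (nbhs_group phi_group_nbhs).

Let sin_pert (u u' : R) (d : R) : `|u' - u| <= d -> `|sin u| - d <= `|sin u'|.
Proof.
move=> h; rewrite lerBlDr -{1}(subrK u' u) addrC.
apply: le_trans (norm_sinD _ _) _; rewrite lerD2l.
by apply: le_trans (norm_sin_le _) _; rewrite distrC.
Qed.

Lemma separate a b : a <> b -> exists2 x, law x & sin (phi x (a - b)) != 0.
Proof.
move=> ab; have [t ct] : exists t, coef t (wd (a - b)) != 0.
  apply: contrapT => H; apply: ab; apply: wd_eq => t; apply/eqP; rewrite -subr_eq0 -coef_wdB.
  by apply: contraT => ct; case: H; exists t.
set w := wd (a - b) in ct *.
(* The word [w] gets the value [pi / 2] from [x0]; with this [d0] the perturbation changes it by at
   most 1/2, and [|sin|] stays positive. *)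
pose d0 : R := (4 * (1 + l1 R w))^-1.
have l0 := l1_ge0 R w.
have d00 : 0 < d0 by rewrite invr_gt0 mulr_gt0 // ltr_pwDl.
pose x0 s : R := if s == t then pi / 2 / (coef t w)%:~R else 0.
have [x [xL xF _]] := exists_limit_law M sel rk (letters w) x0 (fun=> 0) d00.
exists x => //.
have e0 : ev x0 w = pi / 2.
  have tJ : t \in undup (letters w).
    by rewrite mem_undup; apply: contraNT ct => /coef_notin ->.
  rewrite (ev_coef x0 (undup_uniq (letters w))); last by move=> s; rewrite mem_undup.
  rewrite (bigD1_seq t) ?undup_uniq //= big1 => [|s st]; last by rewrite /x0 (negbTE st) mulr0.
  by rewrite addr0 /x0 eqxx mulrC divfK // intr_eq0.
have close := ev_close xF.
have h1 : l1 R w * (2 * d0) <= 1 / 2.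
  rewrite /d0 (_ : _ * _ = l1 R w / (1 + l1 R w) / 2); last by field; rewrite gt_eqF // ltr_pwDl.
  by rewrite ler_pM2r ?invr_gt0 // ler_pdivrMr ?ltr_pwDl // mul1r lerDr.
have := sin_pert (le_trans close h1); rewrite e0 sin_pihalf normr1 => h2.
rewrite -normr_gt0 -/(phi x (a - b)) /phi -/w; apply: lt_le_trans h2; lra.
Qed.

Lemma TG_hausdorff : hausdorff_space TG.
Proof.
move=> a b cl; apply: contrapT => ab; have [x xL sx] := separate ab.
pose e := `|sin (phi x (a - b))| / 2.
have e0 : 0 < e by rewrite divr_gt0 // normr_gt0.
have Xl : forall i, (i < 1)%N -> law ((fun=> x) i) by [].
have nb c : nbhs (c : TG) (ball_phi 1 (fun=> x) e c) by exact: phi_nbhs_ball.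
have [c [ac bc]] := cl _ _ (nb a) (nb b).
have h1 := ac 0%N isT; have h2 := bc 0%N isT.
have : `|sin (phi x (a - b))| < e + e.
  have -> : phi x (a - b) = - phi x (c - a) + phi x (c - b).
    by rewrite !phiB opprB addrA subrK.
  by apply: le_lt_trans (norm_sinD _ _) _; rewrite norm_sinN ltrD.
by rewrite /e -splitr ltxx.
Qed.

Lemma TG_countably_compact : countably_compact {ptws 'I_M -> TG}.
Proof.
move=> u.
pose u' n q : G := if insub q is Some i then u n i else 0.
have [y hy] := seq_accumulation coef_wdB wd_eq ev_wdB ev_gen sel u' (leqnn M).
exists (fun i : 'I_M => y i : TG).
apply: ptws_accumulation => A hA.
pose B q : set G := if insub q is Some i then A i else setT.
have [n [X [e [XL e0 XB]]]] : exists n X e, [/\ forall i, (i < n)%N -> law (X i), 0 < e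
    & forall q, (q < M)%N -> ball_phi n X e (y q) `<=` B q].
  suff : forall l, (l <= M)%N -> exists n X e, [/\ forall i, (i < n)%N -> law (X i), 0 < e
    & forall q, (q < l)%N -> ball_phi n X e (y q) `<=` B q] by apply.
  elim=> [|l IH] lM; first by exists 0%N, (fun _ _ => 0), 1; split.
  have [n [X [e [XL e0 XB]]]] := IH (ltnW lM).
  have [m [Y [d [YL d0 YA]]]] := hA (Ordinal lM).
  have [k [Z [c [ZL c0 ZXY]]]] := ball_phi_merge XL e0 YL d0.
  exists k, Z, c; split => // q; rewrite ltnS leq_eqVlt => /orP[/eqP ->|ql] b /ZXY[bX bY].
    by rewrite /B insubT; exact: YA.
  exact: (XB q ql _ bX).
apply: sub_infinite_set (hy n X e XL e0) => j hj i /=.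
have : B i (u j i).
  apply: XB => // l ln; have := hj i l (ltn_ord i) ln.
  by rewrite /u' valK.
by rewrite /B valK.
Qed.

(** For a candidate limit [y] a single homomorphism is enough: it is small on the coordinates of
    [y], whereas almost every block has a letter at which it is far from 0. *)
Lemma TG_not_countably_compact : ~ countably_compact {ptws 'I_M.+1 -> TG}.
Proof.
move=> /(_ (fun m (i : 'I_M.+1) => gen (block i m)))[y ay].
pose y' (i : 'I_M.+1) : G := y i.
pose F0 := flatten [seq letters (wd (y' i)) | i <- enum 'I_M.+1].
pose L := \sum_(i < M.+1) l1 R (wd (y' i)).
have L0 : 0 <= L by apply: sumr_ge0 => i _; exact: l1_ge0.
(* Chosen so that [y] contributes at most 1/8 and blocks lose at most 1/8; the remaining distance
   3/4 exceeds the radius 1/2 of the neighbourhood. *)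
pose d0 : R := (16 * (1 + L))^-1.
have d00 : 0 < d0 by rewrite invr_gt0 mulr_gt0 // ltr_pwDl.
have L1 : 0 < 1 + L by rewrite ltr_pwDl.
have [x [xL xF [N hN]]] := exists_limit_law M sel rk F0 (fun=> 0) (fun=> 0) d00.
have d0E : 2 * d0 = 8^-1 / (1 + L) by rewrite /d0; field; rewrite gt_eqF.
have d08 : 2 * d0 <= 8^-1.
  by rewrite d0E ler_piMr ?invr_ge0 // invf_le1 // lerDl.
have small i : `|sin (phi x (y' i))| <= 8^-1.
  apply: le_trans (norm_sin_le _) _.
  have -> : phi x (y' i) = phi x (y' i) - ev (fun=> 0) (wd (y' i)).
    by rewrite /ev big1 ?subr0 // => c _; rewrite mulr0.
  apply: le_trans (ev_close (d := 2 * d0) _) _.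
    move=> t tF; apply: xF; apply/flattenP; exists (letters (wd (y' i))) => //.
    by apply: map_f; rewrite mem_enum.
  have lL : l1 R (wd (y' i)) <= L.
    by rewrite /L (bigD1 i) //= lerDl sumr_ge0 // => j _; exact: l1_ge0.
  rewrite d0E mulrCA ler_piMr ?invr_ge0 // ler_pdivrMr // mul1r.
  by apply: le_trans lL _; rewrite lerDr.
have Xl : forall i, (i < 1)%N -> law ((fun=> x) i) by [].
have h0 : (0 : R) < 2^-1 by rewrite invr_gt0.
have nb i : nbhs (y i) (ball_phi 1 (fun=> x) 2^-1 (y' i) : set TG) by exact: phi_nbhs_ball.
have fI : nbhs y [set z : {ptws 'I_M.+1 -> TG} |
    forall i, (ball_phi 1 (fun=> x) 2^-1 (y' i) : set TG) (z i)].
  apply: (@filter_forall _ _ (fun i (z : {ptws 'I_M.+1 -> TG}) =>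
    (ball_phi 1 (fun=> x) 2^-1 (y' i) : set TG) (z i)) (nbhs y) (nbhs_filter y)) => i.
  exact: ptws_nbhs_proj (nb i).
apply: (ay _ fI); apply: sub_finite_set (finite_II N) => b /= hb.
rewrite ltnNge; apply/negP => Nb; have [i iM hi] := hN b Nb.
have := hb (Ordinal (iM : (i < M.+1)%N)) 0%N isT.
rewrite phiB /phi ev_gen /= -/(phi x (y' _)); set v := phi x _ => h1.
have h2 := small (Ordinal (iM : (i < M.+1)%N)); rewrite -/v in h2.
rewrite subr0 in hi.
have : `|sin (x (block i b))| <= `|sin (x (block i b) - v)| + `|sin v|.
  by rewrite -{1}(subrK v (x (block i b))) norm_sinD.
move: h1 h2 hi d08; set s1 := `|sin (_ - v)|; lra.
Qed.

End Topology.

(* [T = G :> zmodType]: [T] is [G] itself, with the same group structure, endowed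
   with a group topology. *)
Theorem mainTheorem4 :
  (exists S : set (set_system nat),
    [/\ has_card_continuum S,
        forall p, S p -> selective p
      & forall p q, S p -> S q -> p <> q -> rk_incomparable p q]) ->
  forall G : zmodType, free_abelian G -> has_card_continuum [set: G] ->
  forall M : nat,
  exists T : topologicalZmodType,
    [/\ T = G :> zmodType,
        hausdorff_space T,
        countably_compact {ptws 'I_M -> T}
      & ~ countably_compact {ptws 'I_M.+1 -> T}].
Proof.
move=> [S [cS Ssel Srk]] G [K [f [g fK gK]]] cG M.
(* Trees, ultrafilters in [S] and basis elements of [G] are equally numerous, so every tree gets an
   ultrafilter and a basis element of its own. *)
have /card_set_bijP[p [pS pI _]] := card_eq_trans card_tree (card_esym cS).
have sel t : selective (p t) by apply: Ssel; exact: pS.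
have rk t t' : t <> t' -> ~ rk_le (p t) (p t').
  move=> tt'; have [] // := Srk (p t) (p t') (pS t I) (pS t' I).
  by move=> e; apply: tt'; apply: pI => //; exact: mem_set.
have /card_set_bijP[bt [_ btI btS]] :=
  card_eq_trans (basis_card fK gK cG) (card_esym card_tree).
have ex t : exists k, bt k = t by have [k _] := btS t I; exists k.
have [tb tbP] := choice ex.
have btK : cancel bt tb by move=> k; apply: btI; rewrite ?inE.
have coefB := coef_wdB fK gK btK tbP.
have wdE := wd_eq gK btK tbP.
have evB := @ev_wdB Rstruct.RbaseSymbolsImpl_R__canonical__reals_Real _ _ _ _ fK gK _ _ btK tbP.
have evG := @ev_gen Rstruct.RbaseSymbolsImpl_R__canonical__reals_Real _ _ _ _ fK _ _ btK tbP.
exists (nbhs_group (phi_group_nbhs evB M p)); split.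
- exact: nbhs_group_zmod.
- exact: (TG_hausdorff coefB wdE sel rk).
- exact: (TG_countably_compact coefB wdE evG sel).
- exact: (TG_not_countably_compact evG sel rk).
Qed.
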